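(* For every integer $n\ge 3$ there exists a nontrivial snark $G$ with $\mathrm{df}(G)\ge n$ which contains a vertex whose inflation to a triangle produces a snark with defect $3$.
   Context: Graphs are finite; loops and multiple edges are allowed. A snark is a $2$-connected cubic graph that does not admit a proper $3$-edge-colouring. A snark is nontrivial if it is cyclically $4$-edge-connected (the removal of fewer than $4$ edges never leaves at least two components containing circuits) and has girth at least $5$. A $3$-array of a cubic graph $G$ is a collection $\{M_1,M_2,M_3\}$ of three not necessarily distinct perfect matchings of $G$. An edge is uncovered if it belongs to none of $M_1,M_2,M_3$. The (colouring) defect $\mathrm{df}(G)$ is the minimum number of uncovered edges over all $3$-arrays of $G$. Inflating a vertex $v$ of a cubic graph to a triangle means replacing $v$ by a triangle, attaching the three edges formerly incident with $v$ to the three distinct vertices of the triangle. *)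

(* Defs.v *)
From mathcomp Require Import all_boot.

Set Implicit Arguments.
Unset Strict Implicit.
Unset Printing Implicit Defensive.

(** Finite graphs with loops and multiple edges.  The pairs [(e, false)] and
    [(e, true)] are the two half-edges of [e]; their order carries no meaning,
    and a loop has both half-edges at the same vertex. *)
Record multigraph := Multigraph {
  vertex : finType;
  edge : finType;
  endpoint : edge * bool -> vertex
}.

Section Multigraph.
Variable G : multigraph.
Implicit Types (x y v : vertex G) (e : edge G) (F C S M : {set edge G}).
Implicit Types (X : {set vertex G}).

Definition half_edges_at v : {set edge G * bool} :=
  [set h | endpoint h == v].

(** Degree of [v] in the spanning subgraph with edge set [F]; a loop counts
    twice. *)
Definition degree_in F v : nat := #|[set h in half_edges_at v | h.1 \in F]|.

Definition cubic : Prop := forall v, degree_in setT v = 3.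

Definition adjacent_in F : rel (vertex G) :=
  fun x y => [exists e in F, exists b,
    (endpoint (e, b) == x) && (endpoint (e, ~~ b) == y)].

Definition connected_in F : rel (vertex G) := connect (adjacent_in F).

Definition connected_avoiding X : Prop :=
  forall x y, x \notin X -> y \notin X ->
    connect [rel u w | [&& u \notin X, w \notin X & adjacent_in setT u w]] x y.

Definition k_connected (k : nat) : Prop :=
  k < #|vertex G| /\ forall X, #|X| < k -> connected_avoiding X.

(** Two half-edges at a common vertex never get the same colour, so a graph
    with a loop has no proper colouring. *)
Definition proper_edge_colouring (k : nat) (c : edge G -> 'I_k) : Prop :=
  forall h1 h2 : edge G * bool,
    h1 != h2 -> endpoint h1 = endpoint h2 -> c h1.1 <> c h2.1.

Definition edge_colourable (k : nat) : Prop :=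
  exists c : edge G -> 'I_k, proper_edge_colouring c.

Definition snark : Prop := [/\ cubic, k_connected 2 & ~ edge_colourable 3].

(** A circuit is a connected 2-regular subgraph, given by its edge set: loops
    are circuits of length 1, pairs of parallel edges circuits of length 2. *)
Definition circuit C : Prop :=
  [/\ C != set0,
      forall v, degree_in C v = 0 \/ degree_in C v = 2
    & forall h1 h2 : edge G * bool, h1.1 \in C -> h2.1 \in C ->
        connected_in C (endpoint h1) (endpoint h2)].

Definition girth_at_least (k : nat) : Prop :=
  forall C, circuit C -> k <= #|C|.

(** The component of [x] in [G - S] contains a circuit. *)
Definition cyclic_component S x : Prop :=
  exists2 C, circuit C &
    forall h : edge G * bool, h.1 \in C ->
      h.1 \notin S /\ connected_in (~: S) x (endpoint h).

Definition cyclically_edge_connected (k : nat) : Prop :=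
  forall S, #|S| < k ->
    ~ exists x y, [/\ cyclic_component S x, cyclic_component S y
                    & ~~ connected_in (~: S) x y].

Definition nontrivial_snark : Prop :=
  [/\ snark, cyclically_edge_connected 4 & girth_at_least 5].

Definition perfect_matching M : bool := [forall v, degree_in M v == 1].

Definition three_array (A : {ffun 'I_3 -> {set edge G}}) : bool :=
  [forall i, perfect_matching (A i)].

Definition uncovered (A : {ffun 'I_3 -> {set edge G}}) : {set edge G} :=
  ~: \bigcup_i A i.

(** The neutral value [#|edge G|] bounds every [#|uncovered A|], so it only
    shows up when there is no 3-array at all; by Petersen's theorem this does
    not happen for 2-connected cubic graphs. *)
Definition defect : nat :=
  \big[minn/#|edge G|]_(A : {ffun 'I_3 -> {set edge G}} | three_array A)
    #|uncovered A|.

End Multigraph.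

Section Inflation.
Variables (G : multigraph) (v : vertex G) (attach : edge G * bool -> 'I_3).

(** The vertex [v] is replaced by the triangle with vertices [inr i] and edges
    [inr i] joining [inr i] to [inr (i + 1 mod 3)].  Each half-edge [h] at [v]
    is moved to [inr (attach h)]; [attach] is irrelevant on other half-edges. *)
Definition inflate_endpoint (h : (edge G + 'I_3) * bool) :
    {u : vertex G | u != v} + 'I_3 :=
  match h with
  | (inl e, b) => if insub (endpoint (e, b)) is Some u then inl u
                  else inr (attach (e, b))
  | (inr i, b) => inr (if b then ordS i else i)
  end.

Definition inflate : multigraph := Multigraph inflate_endpoint.

(** [attach] sends the half-edges at [v] to distinct triangle vertices; for
    cubic [G] all such choices give isomorphic inflations. *)
Definition attaches_distinctly : Prop :=
  {in half_edges_at v &, injective attach}.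

End Inflation.

(* Main.v *)
Require Import Defs.
From mathcomp Require Import all_boot.
From mathcomp Require Import zify.

(** Write p_0, ..., p_4 for the outer pentagon of the Petersen graph.  Replace
    each of the ten other edges by a long chain of copies of the Petersen graph minus two
    vertices at distance 2; consecutive copies, and the copies at the ends, are
    joined by three parallel lanes (only the ends of the spokes at the p_i stay
    single edges).  For three perfect matchings M_1, M_2, M_3, the numbers of
    lanes used by the M_k have the same parities all along a chain, and a copy
    that meets no uncovered edge forces exactly one of these three numbers to be
    odd: otherwise it would yield a 3-edge-colouring of the Petersen graph.
    Hence, if fewer than n edges are uncovered, every chain carries a colour and
    every spoke lies in exactly one M_k.  Round the pentagon the edges then lie
    in an odd number of matchings each, because 5 is odd, which would 3-edge-colour
    the Petersen graph; so the defect is at least n.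
    Yet the graph without the pentagon is 3-edge-colourable, the spokes receiving
    the colours c, a, c, c, b round the pentagon.  Once the vertex at the first
    spoke is inflated, this colouring extends to a 3-array in which the hexagon
    that replaces the pentagon alternates between uncovered and doubly covered
    edges. *)

Set Implicit Arguments.
Unset Strict Implicit.
Unset Printing Implicit Defensive.

(** * Edge cuts, connectivity and girth *)

Lemma sum_half_edges (E : finType) (F : E * bool -> nat) :
  \sum_h F h = \sum_e (F (e, false) + F (e, true)).
Proof.
transitivity (\sum_h F (h.1, h.2)); first by apply: eq_bigr => -[].
rewrite -(pair_bigA _ (fun e b => F (e, b))) /=.
by apply: eq_bigr => e _; rewrite big_bool addnC.
Qed.

(** Evaluates cuts across lanes: a lane with both ends inside a set is counted at each end but not
    cut, a loss of 2. *)
Lemma neq_sum (I : finType) (x y : I -> bool) :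
  \sum_i (x i != y i) + 2 * (\sum_i (x i && y i)) = \sum_i x i + \sum_i y i.
Proof.
rewrite big_distrr -!big_split; apply: eq_bigr => i _ /=.
by case: (x i) (y i) => -[].
Qed.

Section Graph.
Variable G : multigraph.
Implicit Types (X Y : vertex G -> bool) (v : vertex G).

Definition vertex_sum (F : edge G * bool -> nat) v : nat :=
  \sum_h (endpoint h == v) * F h.

Definition cut X : nat :=
  \sum_e (X (endpoint (e, false)) != X (endpoint (e, true))).

Lemma degree_inE (M : {set edge G}) v :
  degree_in M v = vertex_sum (fun h => h.1 \in M) v.
Proof.
rewrite /degree_in -sum1_card big_mkcond; apply: eq_bigr => h _ /=.
by rewrite !inE; case: eqP => _; case: (_ \in _).
Qed.

Lemma cutC X : cut (predC X) = cut X.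
Proof. by apply: eq_bigr => h _; rewrite /= (inj_eq negb_inj). Qed.

Lemma sum_vertex_sum (F : edge G * bool -> nat) X :
  \sum_(v | X v) vertex_sum F v = \sum_h X (endpoint h) * F h.
Proof.
rewrite exchange_big; apply: eq_bigr => h _ /=.
rewrite -big_distrl /=; congr (_ * _).
rewrite big_mkcond (bigD1 (endpoint h)) //= eqxx big1 ?addn0; first by case: (X _).
by move=> v /negPf; rewrite eq_sym => ->; case: (X v).
Qed.

Section CutBounds.
Hypothesis cubicG : cubic G.

Lemma vertex_sum1 v : vertex_sum (fun=> 1) v = 3.
Proof.
rewrite -(cubicG v) degree_inE; apply: eq_bigr => h _.
by rewrite in_setT.
Qed.

(** Degree count: each vertex of [X] has three half-edges; an edge of [E] uses two of them, an edge
    of the cut one. *)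
Lemma cut_inside X (E : {set edge G}) :
  (forall h : edge G * bool, h.1 \in E -> X (endpoint h)) ->
  cut X + 2 * #|E| <= 3 * #|[pred v | X v]|.
Proof.
move=> XE.
have -> : 3 * #|[pred v | X v]| = \sum_(v | X v) vertex_sum (fun=> 1) v.
  under eq_bigr do rewrite vertex_sum1.
  by rewrite sum_nat_const mulnC.
rewrite sum_vertex_sum sum_half_edges -sum1_card big_mkcond big_distrr /= -big_split.
apply: leq_sum => e _ /=.
have := XE (e, false); have := XE (e, true); rewrite /=.
by case: (e \in E) => [-> // -> //|_ _]; case: (X _) (X _) => -[].
Qed.

(** With m inner edges, s vertices of a cubic graph have cut 3s - 2m, so the bound s + 2 says m < s:
    small sets span no circuit. *)
Hypothesis small_cut : forall X,
  0 < #|[pred v | X v]| <= 4 -> #|[pred v | X v]| + 2 <= cut X.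

Lemma loopless (e : edge G) : endpoint (e, false) != endpoint (e, true).
Proof.
apply/negP => /eqP le; set X := pred1 (endpoint (e, true)).
have cX : #|[pred v | X v]| = 1 by rewrite -(card1 (endpoint (e, true))); apply: eq_card.
have := small_cut (X := X); rewrite cX => /(_ isT).
have /cut_inside : forall h : edge G * bool, h.1 \in [set e] -> X (endpoint h).
  by case=> e' b; rewrite inE => /eqP /= ->; case: b; rewrite /X /= ?le.
by rewrite cards1 cX; lia.
Qed.

(** A circuit with k <= 4 edges has k vertices, whose 3k half-edges leave at most k for the cut,
    against the required k + 2. *)
Lemma girth_5_of_cuts : girth_at_least G 5.
Proof.
move=> C [C0 Cdeg _]; rewrite ltnNge; apply/negP => Cle.
set X := fun v => degree_in C v == 2.
have XC (h : edge G * bool) : h.1 \in C -> X (endpoint h).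
  move=> hC; rewrite /X; case: (Cdeg (endpoint h)) => [/eqP|-> //].
  rewrite cards_eq0 => /eqP/setP/(_ h).
  by rewrite !inE eqxx hC.
(* Double count the half-edges of [C]: two per vertex of [X], two per edge. *)
have cX : #|[pred v | X v]| = #|C|.
  apply/eqP; rewrite -(eqn_pmul2r (isT : 0 < 2)); apply/eqP.
  transitivity (\sum_(v | X v) vertex_sum (fun h => h.1 \in C) v).
    rewrite -sum_nat_const; apply: eq_big => // v /eqP <-.
    by rewrite degree_inE.
  rewrite sum_vertex_sum sum_half_edges -sum1_card big_distrl [RHS]big_mkcond /=.
  apply: eq_bigr => e _; have := XC (e, false); have := XC (e, true) => /=.
  by case: ifP => [_ -> // -> //|]; rewrite !muln0.
have := cut_inside XC; have := small_cut (X := X); rewrite cX.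
have : 0 < #|C| by rewrite card_gt0.
by move=> C1 /(_ _); rewrite C1 Cle => /(_ isT); lia.
Qed.

(** All edges leaving the component of [x] in [G - S] lie in [S]. The component and its complement
    each contain a circuit, hence two vertices as there are no loops, so this cut has at least 4
    edges. *)
Lemma cyclically_4_edge_connected_of_cuts :
  (forall X, 1 < #|[pred v | X v]| -> 1 < #|[pred v | ~~ X v]| -> 4 <= cut X) ->
  cyclically_edge_connected G 4.
Proof.
move=> large_cut S S4 [x [y [[C [C0 _ _] Cx] [D [D0 _ _] Dy] nxy]]].
have adj_sym : symmetric (adjacent_in (~: S)).
  move=> u w; apply/exists_inP/exists_inP => -[e eS /existsP[b /andP[h1 h2]]];
    by exists e => //; apply/existsP; exists (~~ b); rewrite negbK h1 h2.
have con_sym : connect_sym (adjacent_in (~: S)).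
  by apply: sym_connect_sym.
set X := fun w => connected_in (~: S) x w.
have XC (h : edge G * bool) : h.1 \in C -> X (endpoint h) by move=> /Cx[].
have XD (h : edge G * bool) : h.1 \in D -> ~~ X (endpoint h).
  move=> /Dy[_ yh]; apply: contra nxy => xh.
  by rewrite /connected_in (connect_trans xh) // con_sym.
have two Y (E : {set edge G}) : E != set0 ->
    (forall h : edge G * bool, h.1 \in E -> Y (endpoint h)) -> 1 < #|[pred v | Y v]|.
  move=> /set0Pn[e eE] YE.
  suff: #|pred2 (endpoint (e, false)) (endpoint (e, true))| <= #|[pred v | Y v]|.
    by rewrite card2 loopless.
  by apply/subset_leq_card/subsetP => v /pred2P[]->; apply: YE.
have := large_cut X (two X C C0 XC) (two (predC X) D D0 XD).
apply/negP; rewrite -ltnNge; apply: leq_ltn_trans S4.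
rewrite -sum1_card [leqRHS]big_mkcond; apply: leq_sum => e _ /=.
case: ifP => [_|eS]; first by case: (_ != _).
suff -> : X (endpoint (e, false)) = X (endpoint (e, true)) by rewrite eqxx.
have adj b : adjacent_in (~: S) (endpoint (e, b)) (endpoint (e, ~~ b)).
  by apply/exists_inP; exists e; rewrite ?inE ?eS //; apply/existsP; exists b; rewrite !eqxx.
by apply/idP/idP => /connect_trans; apply; apply: connect1; [apply: (adj false)|apply: (adj true)].
Qed.

End CutBounds.

(** If deleting at most one vertex separates [x] from [y], the edges leaving the component [Z] of
    [x], and those leaving the rest [W], all end at that vertex. There are at least 2 + 2 of them,
    but its degree is 3. *)
Lemma two_connected_of_cuts :
  cubic G -> 2 < #|vertex G| ->
  (forall X u w, X u -> ~~ X w -> 2 <= cut X) -> k_connected G 2.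
Proof.
move=> cubicG n2 cut2; split=> // X X2 x y xX yX.
apply/idP/negPn/negP => nxy.
set r := (r in connect r) in nxy.
pose Z := connect r x.
pose W v := (v \notin X) && ~~ Z v.
have ZX v : Z v -> v \notin X.
  move=> /connectP[p]; elim/last_ind: p => [_ -> //|p z _].
  by rewrite rcons_path last_rcons => /andP[_ /and3P[_ + _]] ->.
have Zadj (e : edge G) b : Z (endpoint (e, b)) && (endpoint (e, ~~ b) \notin X) ==>
    Z (endpoint (e, ~~ b)).
  apply/implyP => /andP[Ze eX]; apply: (connect_trans Ze); apply: connect1.
  rewrite /r /= (ZX _ Ze) eX /=; apply/exists_inP; exists e; rewrite ?inE //.
  by apply/existsP; exists b; rewrite !eqxx.
have Wy : W y by rewrite /W yX.
have Zx : Z x by apply: connect0.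
have cutZ := cut2 Z x y Zx nxy.
have cutW : 2 <= cut W by apply: (cut2 W y x Wy); rewrite /W negb_and Zx orbT.
suff : cut Z + cut W <= 3 by lia.
have : \sum_(v | v \in X) vertex_sum (fun=> 1) v <= 3.
  under eq_bigr do rewrite vertex_sum1 //.
  by rewrite sum_nat_const; move: X2; case: #|X| => [|[|]].
rewrite sum_vertex_sum sum_half_edges; apply: leq_trans.
rewrite -big_split; apply: leq_sum => e _ /=.
have := Zadj e false; have := Zadj e true.
have := introT implyP (ZX (endpoint (e, false))).
have := introT implyP (ZX (endpoint (e, true))); rewrite /W /=.
by case: (Z _) (Z _) (_ \in X) (_ \in X) => -[] [] [].
Qed.

End Graph.

(** * Three-arrays and the defect *)

Section Arrays.
Variable G : multigraph.
Implicit Types (A : {ffun 'I_3 -> {set edge G}}).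

Lemma three_arrayP A :
  reflect (forall k v, vertex_sum (fun h => h.1 \in A k) v = 1) (three_array A).
Proof.
apply: (iffP forallP) => [A3 k v|A3 k].
  by rewrite -degree_inE; apply/eqP/(forallP (A3 k)).
by apply/forallP => v; rewrite degree_inE A3.
Qed.

Lemma uncoveredE A e : (e \in uncovered A) = [forall k, e \notin A k].
Proof.
rewrite inE -negb_exists; congr negb; apply/bigcupP/existsP => [[k]|[k]].
  by exists k.
by exists k.
Qed.

(** The bound by [#|edge G|] takes care of the neutral value of the minimum. *)
Lemma defect_geq n :
  n <= #|edge G| -> (forall A, three_array A -> n <= #|uncovered A|) ->
  n <= defect G.
Proof.
move=> nE nA; rewrite /defect; elim/big_rec: _ => // A m /nA nm ?.
by rewrite leq_min nm.
Qed.

Lemma defect_leq A : three_array A -> defect G <= #|uncovered A|.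
Proof.
move=> A3; rewrite /defect; have := mem_index_enum A.
elim: (index_enum _) => // B s IHs; rewrite inE big_cons.
case/predU1P => [<-|/IHs le_s]; first by rewrite A3 geq_minl.
by case: ifP => // _; apply: leq_trans (geq_minr _ _) le_s.
Qed.

(** The colour classes of a 3-edge-colouring form a 3-array leaving nothing uncovered: the three
    half-edges at a vertex get distinct, hence all, colours. *)
Lemma not_colourable_of_defect : cubic G -> 0 < defect G -> ~ edge_colourable G 3.
Proof.
move=> cubicG + [c cP]; rewrite ltnNge => /negP; apply.
pose A := [ffun k => [set e | c e == k]].
suff A3 : three_array A.
  apply: leq_trans (defect_leq A3) _; rewrite leqn0 cards_eq0.
  apply/eqP/setP => e; rewrite uncoveredE in_set0; apply/forallP => /(_ (c e)).
  by rewrite ffunE inE eqxx.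
apply/forallP => k; apply/forallP => v.
set D := half_edges_at v.
have D3 : #|D| = 3.
  by rewrite -(cubicG v); apply: eq_card => h; rewrite !inE andbT.
have injc : {in D &, injective (fun h => c h.1)}.
  move=> h h'; rewrite !inE => /eqP hv /eqP hv' cc; apply/eqP/negPn/negP => /cP.
  by rewrite hv hv' => /(_ erefl); rewrite cc.
have /eqP cD : [set c h.1 | h in D] == setT.
  by rewrite eqEcard subsetT card_in_imset // cardsT card_ord D3.
have := in_setT k; rewrite -cD => /imsetP[h hD kh].
apply/cards1P; exists h; apply/setP => h'; rewrite !inE ffunE inE.
apply/andP/eqP => [[hv /eqP ch]|->]; last by rewrite kh; move: hD; rewrite inE.
by apply: injc => //; rewrite ?inE // ch kh.
Qed.

End Arrays.

(** * Poles with three ports on either side *)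

Definition size_of (T : finType) (X : T -> bool) : nat := \sum_v X v.

Lemma size_ofE (T : finType) (X : T -> bool) : size_of X = #|[pred v | X v]|.
Proof. by rewrite -sum1_card big_mkcond; apply: eq_bigr => v _; rewrite inE; case: (X v). Qed.

Lemma size_of_eq0 (T : finType) (X : T -> bool) : size_of X = 0 -> X =1 xpred0.
Proof.
move=> /eqP; rewrite sum_nat_eq0 => /forallP X0 v.
by have := X0 v; case: (X v).
Qed.

Lemma neq_sum_trans (I : finType) (x y z : I -> bool) :
  \sum_i (x i != z i) <= \sum_i (x i != y i) + \sum_i (y i != z i).
Proof. by rewrite -big_split; apply: leq_sum => i _ /=; case: (x i) (y i) (z i) => -[] []. Qed.

Lemma and_suml (I : finType) (x y : I -> bool) : \sum_i (x i && y i) <= \sum_i x i.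
Proof. by apply: leq_sum => i _; case: (x i) (y i) => -[]. Qed.

Lemma and_sumr (I : finType) (x y : I -> bool) : \sum_i (x i && y i) <= \sum_i y i.
Proof. by apply: leq_sum => i _; case: (x i) (y i) => -[]. Qed.

Lemma or_sum (I : finType) (x y : I -> bool) :
  \sum_i x i <= \sum_i (x i || y i) /\ \sum_i y i <= \sum_i (x i || y i).
Proof. by split; apply: leq_sum => i _; case: (x i) (y i) => -[]. Qed.

(** A graph with six dangling edges, the lanes, three on each side. Only their attachment vertices
    are recorded; one vertex may carry several lanes. *)
Record pole := Pole {
  pole_vertex : finType;
  pole_edge : finType;
  pole_end : pole_edge * bool -> pole_vertex;
  port_in : 'I_3 -> pole_vertex;
  port_out : 'I_3 -> pole_vertex
}.

Section PoleDefs.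
Variable N : pole.
Implicit Types (X : pole_vertex N -> bool) (F : pole_edge N -> nat) (l r : 'I_3 -> nat).

Definition pole_sum F l r (y : pole_vertex N) : nat :=
  \sum_h (pole_end h == y) * F h.1
    + \sum_j (port_in N j == y) * l j + \sum_j (port_out N j == y) * r j.

Definition inner_cut X : nat :=
  \sum_e (X (pole_end (e, false)) != X (pole_end (e, true))).

Definition ins X : nat := \sum_j X (port_in N j).
Definition outs X : nat := \sum_j X (port_out N j).
Definition pole_cut X : nat := inner_cut X + ins X + outs X.

Lemma eq_pole_sum F F' l l' r r' y :
  F =1 F' -> l =1 l' -> r =1 r' -> pole_sum F l r y = pole_sum F' l' r' y.
Proof.
move=> eF el er; congr (_ + _ + _); apply: eq_bigr => i _.
- by rewrite eF.
- by rewrite el.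
- by rewrite er.
Qed.

Lemma sum_pole_sum F l r :
  \sum_y pole_sum F l r y = 2 * (\sum_e F e) + \sum_j l j + \sum_j r j.
Proof.
have sum1 (I : finType) (p : I -> pole_vertex N) (f : I -> nat) :
    \sum_y \sum_i (p i == y) * f i = \sum_i f i.
  rewrite exchange_big; apply: eq_bigr => i _ /=.
  rewrite (bigD1 (p i)) //= eqxx mul1n big1 ?addn0 // => y /negPf.
  by rewrite eq_sym => ->.
rewrite !big_split /= !sum1 sum_half_edges; congr (_ + _ + _).
by rewrite big_distrr; apply: eq_bigr => e _; rewrite /= mul2n addnn.
Qed.

Lemma no_ports X : size_of X = 0 -> ins X = 0 /\ outs X = 0.
Proof.
by move=> /size_of_eq0 X0; split; apply: big1 => j _; rewrite X0.
Qed.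

(* [sound_cut] to [sound_girth2] are weak forms of cyclic 5-edge-connectivity and
   girth 5 that are inherited by compositions in series. *)
Record sound_pole : Prop := SoundPole {
  sound_cubic : forall y, pole_sum (fun=> 1) (fun=> 1) (fun=> 1) y = 3;
  sound_even : ~~ odd #|pole_vertex N|;
  sound_linked : forall X (a : 'I_3 -> bool),
    \sum_j (a j != X (port_out N j)) <= inner_cut X + \sum_j (a j != X (port_in N j));
  sound_cut : forall X, (0 < size_of X -> 3 <= pole_cut X) /\
    (1 < size_of X -> 4 <= pole_cut X);
  sound_ports : forall X, (1 < ins X -> 5 <= pole_cut X) /\
    (1 < outs X -> 5 <= pole_cut X);
  sound_girth : forall X, 0 < size_of X <= 4 -> size_of X + 2 <= pole_cut X;
  sound_girth3 : forall X, size_of X <= 3 ->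
    size_of X + 2 * ins X <= pole_cut X /\ size_of X + 2 * outs X <= pole_cut X;
  sound_girth2 : forall X, size_of X <= 2 ->
    size_of X + 2 * (\sum_j (X (port_in N j) || X (port_out N j))) <= pole_cut X
}.

Definition pole_matchings (M : 'I_3 -> pole_edge N -> bool) (l r : 'I_3 -> 'I_3 -> bool) :=
  forall k y, pole_sum (fun e => M k e) (fun j => l k j) (fun j => r k j) y = 1.

Definition missed (E : finType) (M : 'I_3 -> E -> bool) (e : E) : bool :=
  [forall k, ~~ M k e].

(* An edge that leaves the pole counts once, an inner edge twice, so that the
   counts add up under composition in series. *)
Definition robust (n : nat) : Prop :=
  forall (M : 'I_3 -> pole_edge N -> bool) (l r : 'I_3 -> 'I_3 -> bool),
    pole_matchings M l r ->
    2 * (\sum_e missed M e) + \sum_j missed l j + \sum_j missed r j < n ->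
    \sum_k odd (\sum_j l k j) = 1.

(** A 3-edge-colouring of the pole with its lanes, expressed through the colour classes as
    matchings. *)
Definition transmits (s t : 'I_3 -> 'I_3) : Prop :=
  exists c : pole_edge N -> 'I_3,
    pole_matchings (fun k e => c e == k) (fun k j => s j == k) (fun k j => t j == k).

(** The parity lemma: the degrees in one matching sum to the even number of vertices, and inner
    edges contribute 2 each. *)
Lemma pole_parity : sound_pole -> forall M (l r : 'I_3 -> 'I_3 -> bool), pole_matchings M l r ->
  forall k, odd (\sum_j l k j) = odd (\sum_j r k j).
Proof.
move=> sN M l r MN k; have := sound_even sN.
have -> : #|pole_vertex N| = \sum_y pole_sum (fun e => M k e) (fun j => l k j) (fun j => r k j) y.
  by rewrite -sum1_card; apply: eq_bigr => y _; rewrite MN.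
by rewrite sum_pole_sum mul2n !oddD odd_double; case: odd (odd _) => -[].
Qed.

(** Taking for [a] the values of [X] at the ingoing ports, [sound_linked] bounds by [inner_cut X]
    the number of lanes on which both sides disagree. *)
Lemma sound_balanced : sound_pole -> forall X,
  ins X <= inner_cut X + outs X /\ outs X <= inner_cut X + ins X.
Proof.
move=> sN X; rewrite /ins /outs.
have := sound_linked sN X (fun j => X (port_in N j)).
have := neq_sum (fun j => X (port_in N j)) (fun j => X (port_out N j)).
have := and_suml (fun j => X (port_in N j)) (fun j => X (port_out N j)).
have := and_sumr (fun j => X (port_in N j)) (fun j => X (port_out N j)).
rewrite /= [\sum_j (X (port_in N j) != X (port_in N j))]big1 => [|j _].
  by lia.
by rewrite eqxx.
Qed.

End PoleDefs.

Section Series.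
Variables N1 N2 : pole.

Definition series_end (h : (pole_edge N1 + (pole_edge N2 + 'I_3)) * bool) :
    pole_vertex N1 + pole_vertex N2 :=
  match h with
  | (inl e, b) => inl (pole_end (e, b))
  | (inr (inl e), b) => inr (pole_end (e, b))
  | (inr (inr j), b) => if b then inr (port_in N2 j) else inl (port_out N1 j)
  end.

Definition series : pole :=
  Pole series_end (fun j => inl (port_in N1 j)) (fun j => inr (port_out N2 j)).

Implicit Type X : pole_vertex series -> bool.

Lemma size_of_series X :
  size_of X = size_of (fun y : pole_vertex N1 => X (inl y))
            + size_of (fun y : pole_vertex N2 => X (inr y)).
Proof. by rewrite /size_of big_sumType. Qed.

Lemma inner_cut_series X :
  inner_cut X = inner_cut (fun y : pole_vertex N1 => X (inl y))
    + inner_cut (fun y : pole_vertex N2 => X (inr y))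
    + \sum_j (X (inl (port_out N1 j)) != X (inr (port_in N2 j))).
Proof. by rewrite /inner_cut !big_sumType /= addnA. Qed.

Lemma pole_sum_series_inl F l r (y : pole_vertex N1) :
  pole_sum (N := series) F l r (inl y) =
  pole_sum (fun e => F (inl e)) l (fun j => F (inr (inr j))) y.
Proof.
rewrite /pole_sum !sum_half_edges !big_sumType /=.
rewrite [X in _ + (X + _)]big1 // [X in _ + _ + X]big1 //.
rewrite add0n addn0 addnAC; congr (_ + _ + _).
by apply: eq_bigr => j _; rewrite mul0n addn0.
Qed.

Lemma pole_sum_series_inr F l r (y : pole_vertex N2) :
  pole_sum (N := series) F l r (inr y) =
  pole_sum (fun e => F (inr (inl e))) (fun j => F (inr (inr j))) r y.
Proof.
rewrite /pole_sum !sum_half_edges !big_sumType /=.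
by rewrite [X in X + _ + _ + _]big1 // [X in _ + X + _]big1 // add0n addn0.
Qed.

Lemma series_matchings M l r :
  pole_matchings (N := series) M l r ->
  pole_matchings (fun k e => M k (inl e)) l (fun k j => M k (inr (inr j)))
  /\ pole_matchings (fun k e => M k (inr (inl e))) (fun k j => M k (inr (inr j))) r.
Proof.
move=> MN; split=> k y.
  by have := MN k (inl y); rewrite pole_sum_series_inl.
by have := MN k (inr y); rewrite pole_sum_series_inr.
Qed.

Lemma series_transmits s t u :
  transmits N1 s t -> transmits N2 t u -> transmits series s u.
Proof.
move=> [c1 c1P] [c2 c2P].
exists (fun e => match e with
  | inl e => c1 e | inr (inl e) => c2 e | inr (inr j) => t j end) => k [] y.
  by rewrite pole_sum_series_inl.
by rewrite pole_sum_series_inr.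
Qed.

(** If the first pole accounts for at least [m] of the count, fewer than [n] remain for the second,
    a joining lane counting once on either side. Parity then carries the conclusion back through the
    first pole. *)
Lemma series_robust m n :
  sound_pole N1 -> robust N1 m -> robust N2 n -> robust series (m + n).
Proof.
move=> sN1 r1 r2 M l r /series_matchings[MN1 MN2].
rewrite !big_sumType /= => few.
pose M1 k (e : pole_edge N1) := M k (inl e).
pose M2 k (e : pole_edge N2) := M k (inr (inl e)).
pose L k (j : 'I_3) := M k (inr (inr j)).
have {}few : 2 * (\sum_e missed M1 e + (\sum_e missed M2 e + \sum_j missed L j))
    + \sum_j missed l j + \sum_j missed r j < m + n := few.
have [/(r1 _ _ _ MN1)//|le_m] := ltnP (2 * (\sum_e missed M1 e) + \sum_j missed l j
  + \sum_j missed L j) m.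
under eq_bigr do rewrite (pole_parity sN1 MN1).
by apply: r2 MN2 _; rewrite -/M2 -/L; lia.
Qed.

(** A joining lane inside [X] is counted in both pole cuts and is not cut, whence [cutE]. As the
    poles are balanced, forgetting one of them never enlarges the cut ([cut1], [cut2]). The bounds
    then follow arithmetically from those of the two poles. *)
Lemma series_sound : sound_pole N1 -> sound_pole N2 -> sound_pole series.
Proof.
move=> s1 s2.
have cutE X : pole_cut X
    + 2 * (\sum_j (X (inl (port_out N1 j)) && X (inr (port_in N2 j)))) =
    pole_cut (fun y : pole_vertex N1 => X (inl y))
      + pole_cut (fun y : pole_vertex N2 => X (inr y)).
  rewrite /pole_cut inner_cut_series /ins /outs /=.
  have := neq_sum (fun j => X (inl (port_out N1 j))) (fun j => X (inr (port_in N2 j))) => /=.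
  lia.
have linkl X := and_suml (fun j => X (inl (port_out N1 j))) (fun j => X (inr (port_in N2 j))).
have linkr X := and_sumr (fun j => X (inl (port_out N1 j))) (fun j => X (inr (port_in N2 j))).
have cut1 X : pole_cut (fun y : pole_vertex N1 => X (inl y)) <= pole_cut X.
  have := cutE X; have := sound_balanced s2 (fun y => X (inr y)).
  have := linkr X; rewrite /pole_cut /ins /outs /=; lia.
have cut2 X : pole_cut (fun y : pole_vertex N2 => X (inr y)) <= pole_cut X.
  have := cutE X; have := sound_balanced s1 (fun y => X (inl y)).
  have := linkl X; rewrite /pole_cut /ins /outs /=; lia.
have insE X : ins X = ins (fun y : pole_vertex N1 => X (inl y)) by [].
have outsE X : outs X = outs (fun y : pole_vertex N2 => X (inr y)) by [].
split=> [y||X a|X|X|X|X|X].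
- case: y => y; rewrite ?pole_sum_series_inl ?pole_sum_series_inr;
    [exact: sound_cubic s1 y | exact: sound_cubic s2 y].
- by rewrite card_sum oddD (negPf (sound_even s1)) (negPf (sound_even s2)).
- have := sound_linked s1 (fun y => X (inl y)) a.
  have := sound_linked s2 (fun y => X (inr y)) (fun j => X (inl (port_out N1 j))).
  have := neq_sum_trans a (fun j => X (inl (port_out N1 j))) (fun j => X (port_out series j)).
  rewrite inner_cut_series /=; lia.
- have := sound_cut s1 (fun y => X (inl y)); have := sound_cut s2 (fun y => X (inr y)).
  have := sound_girth3 s1 (X := fun y => X (inl y)).
  have := cut1 X; have := cut2 X; have := cutE X; have := linkl X; rewrite size_of_series.
  rewrite /outs; lia.
- have := sound_ports s1 (fun y => X (inl y)); have := sound_ports s2 (fun y => X (inr y)).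
  have := cut1 X; have := cut2 X; rewrite insE outsE; lia.
- have := sound_girth s1 (X := fun y => X (inl y)).
  have := sound_girth s2 (X := fun y => X (inr y)).
  have := sound_girth3 s1 (X := fun y => X (inl y)).
  have := cut1 X; have := cut2 X; have := cutE X; have := linkl X; rewrite size_of_series.
  rewrite /outs; lia.
- have := sound_girth3 s1 (X := fun y => X (inl y)).
  have := sound_girth3 s2 (X := fun y => X (inr y)).
  have := sound_girth2 s1 (X := fun y => X (inl y)).
  have := sound_girth2 s2 (X := fun y => X (inr y)).
  have := no_ports (X := fun y => X (inl y)).
  have := no_ports (X := fun y => X (inr y)).
  have := cut1 X; have := cut2 X; have := cutE X; have := linkl X; have := linkr X.
  have := or_sum (fun j => X (inl (port_in N1 j))) (fun j => X (inl (port_out N1 j))).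
  have := or_sum (fun j => X (inr (port_in N2 j))) (fun j => X (inr (port_out N2 j))).
  rewrite size_of_series insE outsE /ins /outs /=.
  lia.
- have := sound_girth2 s1 (X := fun y => X (inl y)).
  have := sound_girth2 s2 (X := fun y => X (inr y)).
  have := cutE X; rewrite size_of_series /=.
  suff : \sum_j (X (inl (port_in N1 j)) || X (inr (port_out N2 j)))
      + \sum_j (X (inl (port_out N1 j)) && X (inr (port_in N2 j)))
      <= \sum_j (X (inl (port_in N1 j)) || X (inl (port_out N1 j)))
        + \sum_j (X (inr (port_in N2 j)) || X (inr (port_out N2 j))).
    by rewrite /=; lia.
  rewrite -!big_split; apply: leq_sum => j _ /=.
  by case: (X _) (X _) (X _) (X _) => -[] [] [].
Qed.

End Series.

(** * The Petersen graph minus two vertices *)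

Section Backtracking.
Variables (T : eqType) (vals : seq T) (ok goal : seq T -> bool).

(* [goal s] for all [s] over [vals] of length [n] all of whose prefixes are [ok]. *)
Fixpoint search n (s : seq T) : bool :=
  if ok s then
    if n is n'.+1 then all (fun v => search n' (rcons s v)) vals else goal s
  else true.

Lemma searchP n : search n [::] -> forall s, size s = n -> {subset s <= vals} ->
  (forall i, ok (take i s)) -> goal s.
Proof.
suff: forall u, search n u -> forall s, size s = n -> {subset s <= vals} ->
    (forall i, ok (u ++ take i s)) -> goal (u ++ s) by move/(_ [::]).
elim: n => [|n IHn] u /=.
  by move=> + [|//] _ _ ok_u; have := ok_u 0; rewrite /= !cats0 => ->.
move=> + [//|v s] [sz] sub ok_u; have := ok_u 0; rewrite take0 cats0 => ->.
move=> /allP/(_ v (sub _ (mem_head _ _)))/IHn/(_ s sz).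
rewrite cat_rcons; apply=> [x xs|i]; first by apply: sub; rewrite inE xs orbT.
by rewrite cat_rcons; apply: (ok_u i.+1).
Qed.

End Backtracking.

Lemma sum_ord_iota n (F : 'I_n.+1 -> nat) : \sum_i F i = \sum_(i <- iota 0 n.+1) F (inord i).
Proof.
rewrite -[iota 0 _]/(index_iota 0 n.+1) big_mkord.
by apply: eq_bigr => i _; rewrite inord_val.
Qed.

Lemma sum_delta (V : eqType) (l : seq (V * nat)) (F : nat -> nat) v :
  \sum_(p <- l) (p.1 == v) * F p.2 = \sum_(i <- [seq p.2 | p <- l & p.1 == v]) F i.
Proof.
rewrite big_map big_filter [RHS]big_mkcond.
by apply: eq_bigr => p _ /=; case: eqP; rewrite ?mul1n.
Qed.

Lemma inord_eq n i (v : 'I_n.+1) : i < n.+1 -> (inord i == v) = (i == v :> nat).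
Proof. by move=> lt_i; rewrite -val_eqE /= inordK. Qed.

(** Vertex sets as bit lists, the form in which [search] enumerates them. *)
Definition bits n (X : 'I_n.+1 -> bool) : seq bool := mkseq (fun i => X (inord i)) n.+1.

Lemma nth_bits n (X : 'I_n.+1 -> bool) i : i < n.+1 -> nth false (bits X) i = X (inord i).
Proof. by move=> lt_i; rewrite nth_mkseq. Qed.

Lemma size_of_bits n (X : 'I_n.+1 -> bool) : size_of X = count id (bits X).
Proof.
rewrite /size_of sum_ord_iota -sum1_count [RHS]big_mkcond big_map.
by apply: eq_bigr => i _ /=; case: (X _).
Qed.

Definition bit_sum (s : seq bool) (l : seq nat) : nat := sumn [seq nat_of_bool (nth false s i) | i <- l].
Definition bit_cut (s : seq bool) (l : seq (nat * nat)) : nat :=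
  sumn [seq nat_of_bool (nth false s p.1 != nth false s p.2) | p <- l].

Lemma sumn_map (T : Type) (l : seq T) (F : T -> nat) : sumn (map F l) = \sum_(i <- l) F i.
Proof. by rewrite sumnE big_map. Qed.

(* Petersen graph without two vertices at distance 2, whose common neighbour is 0. *)
Definition petersen_edges : seq (nat * nat) :=
  [:: (0, 5); (1, 3); (2, 4); (1, 6); (2, 7); (3, 7); (4, 6); (5, 6); (5, 7)].
Definition petersen_ins : seq nat := [:: 0; 1; 2].
Definition petersen_outs : seq nat := [:: 0; 3; 4].

Definition list_end n (l : seq (nat * nat)) (e : nat) (b : bool) : 'I_n.+1 :=
  inord (if b then (nth (0, 0) l e).2 else (nth (0, 0) l e).1).

Definition petersen_pole : pole :=
  @Pole 'I_8 'I_9 (fun h => list_end 7 petersen_edges h.1 h.2)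
    (fun j => inord (nth 0 petersen_ins j)) (fun j => inord (nth 0 petersen_outs j)).

(* Slots 0-8 are the edges, 9-11 the ingoing and 12-14 the outgoing lanes. *)
Definition petersen_incidences : seq (nat * nat) :=
  zip (unzip1 petersen_edges) (iota 0 9) ++ zip (unzip2 petersen_edges) (iota 0 9)
    ++ zip petersen_ins (iota 9 3) ++ zip petersen_outs (iota 12 3).

Definition slots_at (l : seq (nat * nat)) (v : nat) : seq nat := [seq p.2 | p <- l & p.1 == v].

Definition petersen_slot (T : Type) (F : 'I_9 -> T) (l r : 'I_3 -> T) (i : nat) : T :=
  if i < 9 then F (inord i) else if i < 12 then l (inord (i - 9)) else r (inord (i - 12)).

Lemma petersen_sumE (F : 'I_9 -> nat) (l r : 'I_3 -> nat) (y : 'I_8) :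
  pole_sum (N := petersen_pole) F l r y =
  \sum_(i <- slots_at petersen_incidences y) petersen_slot F l r i.
Proof.
rewrite -(sum_delta _ _ (y : nat)) /pole_sum sum_half_edges big_split /= !sum_ord_iota.
rewrite /= !big_cons !big_nil /list_end /=.
rewrite !inordK //= !inord_eq //= !addn0 /petersen_slot /=.
by rewrite !addnA.
Qed.

Lemma search_bits n (goal : seq bool -> bool) (X : 'I_n.+1 -> bool) :
  search [:: true; false] xpredT goal n.+1 [::] -> goal (bits X).
Proof.
move=> /searchP; apply; rewrite ?size_mkseq // => b _.
by case: b; rewrite !inE.
Qed.

Definition neq_count (a b : seq bool) (l : seq nat) : nat :=
  sumn [seq nat_of_bool (nth false a j != nth false b (nth 0 l j)) | j <- iota 0 3].

(** All conditions of [sound_pole] that concern a vertex set; the inner [search] runs over the eight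
    choices of [a] in [sound_linked]. *)
Definition petersen_cut_check (s : seq bool) : bool :=
  let c0 := bit_cut s petersen_edges in
  let i := bit_sum s petersen_ins in
  let o := bit_sum s petersen_outs in
  let io := sumn [seq nat_of_bool (nth false s (nth 0 petersen_ins j)
    || nth false s (nth 0 petersen_outs j)) | j <- iota 0 3] in
  let c := c0 + i + o in
  let z := count id s in
  [&& (0 < z) ==> (3 <= c), (1 < z) ==> (4 <= c),
      (1 < i) ==> (5 <= c), (1 < o) ==> (5 <= c),
      (0 < z <= 4) ==> (z + 2 <= c),
      (z <= 3) ==> (z + 2 * i <= c), (z <= 3) ==> (z + 2 * o <= c) &
      (z <= 2) ==> (z + 2 * io <= c)] &&
      search [:: true; false] xpredT
        (fun a => neq_count a s petersen_outs <= c0 + neq_count a s petersen_ins) 3 [::].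

Lemma bit_sumE n (X : 'I_n.+1 -> bool) l : size l = 3 -> all (gtn n.+1) l ->
  \sum_(j < 3) X (inord (nth 0 l j)) = bit_sum (bits X) l.
Proof.
move=> sz /allP lt_l; rewrite /bit_sum sumn_map (big_nth 0) big_mkord sz.
by apply: eq_bigr => j _; rewrite nth_bits //; apply: lt_l; rewrite mem_nth ?sz.
Qed.

Lemma neq_countE n (a : 'I_3 -> bool) l (X : 'I_n.+1 -> bool) :
  size l = 3 -> all (gtn n.+1) l ->
  \sum_(j < 3) (a j != X (inord (nth 0 l j))) = neq_count (bits a) (bits X) l.
Proof.
move=> sz /allP lt_l; rewrite /neq_count sumn_map -[iota 0 3]/(index_iota 0 3) big_mkord.
apply: eq_bigr => j _; rewrite nth_bits // inord_val nth_bits //.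
by apply: lt_l; rewrite mem_nth ?sz.
Qed.

Lemma bit_cutE n m (X : 'I_n.+1 -> bool) l : size l = m -> all (fun p => (p.1 <= n) && (p.2 <= n)) l ->
  \sum_(e < m) (X (list_end n l e false) != X (list_end n l e true)) = bit_cut (bits X) l.
Proof.
move=> sz /allP lt_l; rewrite /bit_cut sumn_map (big_nth (0, 0)) big_mkord sz.
apply: eq_bigr => j _; rewrite /list_end.
have lt_j : j < size l by rewrite sz.
by have /andP[? ?] := lt_l _ (mem_nth (0, 0) lt_j); rewrite !nth_bits.
Qed.

Lemma petersen_cut_search : search [:: true; false] xpredT petersen_cut_check 8 [::].
Proof. by vm_compute. Qed.

Lemma petersen_sound : sound_pole petersen_pole.
Proof.
have icE X : inner_cut (N := petersen_pole) X = bit_cut (bits X) petersen_edges by exact: bit_cutE.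
have insE X : ins (N := petersen_pole) X = bit_sum (bits X) petersen_ins by exact: bit_sumE.
have outsE X : outs (N := petersen_pole) X = bit_sum (bits X) petersen_outs by exact: bit_sumE.
have orE X : \sum_j (X (port_in petersen_pole j) || X (port_out petersen_pole j)) =
    sumn [seq nat_of_bool (nth false (bits X) (nth 0 petersen_ins j)
      || nth false (bits X) (nth 0 petersen_outs j)) | j <- iota 0 3].
  rewrite sumn_map -[iota 0 3]/(index_iota 0 3) big_mkord.
  by apply: eq_bigr => -[[|[|[|]]] //= _] _.
have szE (X : pole_vertex petersen_pole -> bool) : size_of X = count id (bits X) := size_of_bits X.
have chkX (X : 'I_8 -> bool) := search_bits X petersen_cut_search.
split=> [y||X a|X|X|X|X|X].
- rewrite petersen_sumE; case: y => y /= lt_y; rewrite -sumn_map.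
  suff /allP/(_ y) : all (fun y => sumn [seq petersen_slot (fun=> 1) (fun=> 1) (fun=> 1) i
      | i <- slots_at petersen_incidences y] == 3) (iota 0 8).
    by rewrite mem_iota => /(_ lt_y)/eqP.
  by vm_compute.
- by rewrite card_ord.
- have -> : \sum_j (a j != X (port_out petersen_pole j)) = neq_count (bits a) (bits X) petersen_outs.
    exact: neq_countE.
  have -> : \sum_j (a j != X (port_in petersen_pole j)) = neq_count (bits a) (bits X) petersen_ins.
    exact: neq_countE.
  rewrite icE; by have /andP[_ /search_bits] := chkX X; apply.
all: have /andP[] := chkX X; rewrite /pole_cut icE insE outsE ?szE.
all: case/and5P=> c1 c2 c3 c4 /and4P[c5 c6 c7 c8] _.
- by split; apply/implyP.
- by split; apply/implyP.
- by apply/implyP.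
- by move=> z; rewrite (implyP c6 z) (implyP c7 z).
- by rewrite orE; apply/implyP.
Qed.

(** * Triples of matchings on one copy *)

(* The subset of the three matchings that contain a given edge. *)
Definition cover3 : Type := (bool * bool * bool)%type.

Definition in_cover (k : nat) (c : cover3) : bool :=
  match k with 0 => c.1.1 | 1 => c.1.2 | _ => c.2 end.

Definition cover_of (w : 'I_3 -> bool) : cover3 :=
  (w (inord 0), w (inord 1), w (inord 2)).

Definition covers : seq cover3 :=
  [seq (ab, c) | ab <- [seq (a, b) | a <- [:: false; true], b <- [:: false; true]],
                 c <- [:: false; true]].

Definition uncovering : cover3 := (false, false, false).

Lemma mem_covers c : c \in covers.
Proof. by case: c => [[[] []] []]. Qed.

Lemma in_cover_of w (k : 'I_3) : in_cover k (cover_of w) = w k.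
Proof.
by rewrite -[k in RHS]inord_val /cover_of; case: k => -[|[|[|]]].
Qed.

Definition count_covers (p : pred nat) (s : seq cover3) : bool :=
  all (fun k => p (count (in_cover k) s)) (iota 0 3).

(** The pruning test: no matching occurs twice among the slots assigned so far at a vertex, and each
    occurs once when the vertex is complete. *)
Definition partial_check (slots : seq (seq nat)) (s : seq cover3) : bool :=
  all (fun sl => let js := [seq j <- sl | j < size s] in
    let vs := [seq nth uncovering s j | j <- js] in
    count_covers (geq 1) vs && ((js == sl) ==> count_covers (pred1 1) vs)) slots.

Lemma partial_check_take slots s :
  all (fun sl => all (gtn (size s)) sl && count_covers (pred1 1) [seq nth uncovering s j | j <- sl]) slots ->
  forall i, partial_check slots (take i s).
Proof.
move=> /allP full i; apply/allP => sl /full/andP[/allP lt_sl /allP cnt] /=.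
have -> : [seq nth uncovering (take i s) j | j <- sl & j < size (take i s)] =
    [seq nth uncovering s j | j <- sl & j < size (take i s)].
  apply/eq_in_map => j; rewrite mem_filter size_take_min ltn_min => /andP[/andP[lt_j _] _].
  by rewrite nth_take.
apply/andP; split; last by apply/implyP => /eqP ->; apply/allP.
apply/allP => k /cnt /eqP cnt1; apply: leq_trans (eq_leq cnt1).
by apply: leq_count_subseq; rewrite map_subseq ?filter_subseq.
Qed.

Definition petersen_slots : seq (seq nat) :=
  Eval vm_compute in [seq slots_at petersen_incidences y | y <- iota 0 8].

Lemma mem_petersen_slots y : y < 8 -> slots_at petersen_incidences y \in petersen_slots.
Proof.
rewrite (_ : petersen_slots = [seq slots_at petersen_incidences y | y <- iota 0 8]) //.
by move=> lt_y; apply: map_f; rewrite mem_iota.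
Qed.

Lemma petersen_slots_lt sl : sl \in petersen_slots -> all (gtn 15) sl.
Proof. by apply/allP: sl. Qed.

(** [behead] removes [uncovering]. Three nonempty covers at each vertex are then singletons, so they
    3-edge-colour the copy. Three odd counts would mean distinct colours on the ingoing lanes, and
    by parity on the outgoing ones, which would colour the Petersen graph. *)
Lemma petersen_search : search (behead covers) (partial_check petersen_slots)
  (fun s => sumn [seq nat_of_bool (odd (count (in_cover k) (take 3 (drop 9 s)))) | k <- iota 0 3] == 1)
  15 [::].
Proof. by vm_compute. Qed.

Lemma petersen_robust : robust petersen_pole 1.
Proof.
move=> M l r MT few.
have hit (E : finType) (N : 'I_3 -> E -> bool) : \sum_e missed N e = 0 ->
    forall e, cover_of (N^~ e) != uncovering.
  move=> /size_of_eq0 N0 e; apply/negP => /eqP [N0e N1e N2e].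
  have /negP := N0 e; apply; apply/forallP => k.
  by rewrite -[k]inord_val; case: k => -[|[|[|]]] //= _; rewrite ?N0e ?N1e ?N2e.
have hM := hit _ M; have hl := hit _ l; have hr := hit _ r.
have {}hM := hM ltac:(lia); have {}hl := hl ltac:(lia); have {}hr := hr ltac:(lia).
pose w i k := petersen_slot (M k) (l k) (r k) i.
pose s := mkseq (fun i => cover_of (w i)) 15.
have slot_sum y k : y < 8 -> \sum_(i <- slots_at petersen_incidences y) w i k = 1.
  move=> lt_y; have := MT k (inord y).
  rewrite petersen_sumE => def1; rewrite -[RHS]def1 (inordK lt_y).
  apply: eq_bigr => i _; rewrite /w /petersen_slot.
  by case: (i < 9); case: (i < 12).
have nz c : c != uncovering -> c \in behead covers.
  by move: c; do 3!case=> [] //; move=> [] [].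
have sub : {subset s <= behead covers}.
  move=> c /mapP[i _ ->].
  apply: nz; rewrite /w /petersen_slot; case: (i < 9); first exact: hM.
  by case: (i < 12).
have pre : forall i, partial_check petersen_slots (take i s).
  apply: partial_check_take; rewrite size_mkseq.
  apply/allP => sl sl_in.
  have [y lt_y def_sl] : exists2 y, y < 8 & sl = slots_at petersen_incidences y.
    have : sl \in [seq slots_at petersen_incidences y | y <- iota 0 8] by [].
    by case/mapP => y; rewrite mem_iota => ? ->; exists y.
  have lt_sl := petersen_slots_lt sl_in.
  rewrite lt_sl; apply/allP => k; rewrite mem_iota => lt_k.
  rewrite /= count_map -(slot_sum y (inord k) lt_y) -def_sl.
  apply/eqP; rewrite -sum1_count [LHS]big_mkcond; apply: eq_big_seq => j /(allP lt_sl) lt_j.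
  rewrite /= nth_mkseq // -[k in in_cover k](inordK lt_k) in_cover_of.
  by case: (w j _).
have /eqP def1 := searchP petersen_search (size_mkseq _ _) sub pre.
rewrite sum_ord_iota -{}[RHS]def1 sumn_map.
apply: eq_big_seq => k; rewrite mem_iota => lt_k.
have inw i : in_cover k (cover_of (w i)) = w i (inord k).
  by rewrite -{1}(inordK lt_k) in_cover_of.
rewrite sum_ord_iota !big_cons big_nil [drop _ _]/= [take _ _]/= [count _ _]/= !inw.
by rewrite /w /petersen_slot.
Qed.

(** * Colourings transmitted by chains *)

Definition colours (l : seq nat) (j : nat) : 'I_3 := inord (nth 0 l j).

(** A certificate for [transmits]: [c] colours the nine inner edges, and [c ++ s ++ t] follows the
    slot numbering. *)
Definition petersen_colouring_check (s t c : seq nat) : bool :=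
  [&& size s == 3, size c == 9, all (gtn 3) (c ++ s ++ t) &
    all (fun sl => perm_eq [seq nth 0 (c ++ s ++ t) i | i <- sl] (iota 0 3)) petersen_slots].

Lemma petersen_transmits s t c : petersen_colouring_check s t c ->
  transmits petersen_pole (fun j => colours s j) (fun j => colours t j).
Proof.
case/and4P=> /eqP ss /eqP sc /allP lt3 /allP chk.
exists (fun e : 'I_9 => colours c e) => k y.
have lt_nth i : nth 0 (c ++ s ++ t) i < 3.
  by have [/(mem_nth 0)/lt3//|?] := ltnP i (size (c ++ s ++ t)); rewrite nth_default.
have slots_y := mem_petersen_slots (ltn_ord y).
rewrite petersen_sumE; have /permP/(_ (pred1 (k : nat))) := chk _ slots_y.
have -> : count (pred1 (k : nat)) (iota 0 3) = 1 by case: k => -[|[|[|]]].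
move=> cnt1; rewrite -[RHS]cnt1.
rewrite count_map -sum1_count [RHS]big_mkcond; apply: eq_big_seq => i.
move=> /(allP (petersen_slots_lt slots_y)) lt_i.
rewrite /petersen_slot /colours /= !nth_cat ss sc; have := lt_nth i; rewrite !nth_cat ss sc.
case: (ltnP i 9) => [i9|i9]; first by rewrite inordK // => ?; rewrite inord_eq //; case: eqP.
have -> : (i - 9 < 3) = (i < 12) by lia.
have lt_i12 : i - 12 < 3 by move: lt_i => /=; lia.
have -> : i - 9 - 3 = i - 12 by lia.
case: (ltnP i 12) => [i12|i12] lt_x; rewrite inordK ?inord_eq //; try lia; by case: eqP.
Qed.

(** In the colourings used below one copy changes the colours of the lanes and a second restores
    them, so a chain of pairs of any length transmits them unchanged. *)
Definition petersen_pair : pole := series petersen_pole petersen_pole.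

Definition chain (n : nat) : pole := iter n (series petersen_pair) petersen_pair.

Lemma chain_sound n : sound_pole (chain n).
Proof.
have s2 : sound_pole petersen_pair by apply: series_sound; apply: petersen_sound.
by elim: n => // n IHn; apply: series_sound.
Qed.

(** [chain n] consists of n + 1 pairs, and each copy contributes 1. *)
Lemma chain_robust n : robust (chain n) (2 * n.+1).
Proof.
have r2 : robust petersen_pair 2.
  by apply: (series_robust petersen_sound) petersen_robust petersen_robust.
elim: n => // n IHn; rewrite mulnS; apply: series_robust r2 IHn.
by apply: series_sound; apply: petersen_sound.
Qed.

Lemma card_chain n : n < #|pole_edge (chain n)|.
Proof.
have cE N1 N2 : #|pole_edge (series N1 N2)| = #|pole_edge N1| + (#|pole_edge N2| + 3).
  by rewrite !card_sum card_ord.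
elim: n => [|n IHn]; rewrite [chain _]/= cE; last by rewrite -/(chain n); lia.
lia.
Qed.

(** The lane colourings that occur in [site_states]. *)
Definition chain_states : seq (seq nat) :=
  [:: [:: 1; 2; 1]; [:: 1; 0; 1]; [:: 2; 1; 2]; [:: 0; 2; 0]; [:: 0; 0; 0]].

Lemma chain_transmits n s : s \in chain_states ->
  transmits (chain n) (fun j => colours s j) (fun j => colours s j).
Proof.
move=> s_in; suff t2 : transmits petersen_pair (fun j => colours s j) (fun j => colours s j).
  by elim: n => // n; apply: series_transmits.
move: s_in; rewrite !inE => /or4P[/eqP->|/eqP->|/eqP->|/orP[]/eqP->].
(* Each case supplies the colours of the lanes between the two copies and of the inner edges of
   either copy. *)
- apply: series_transmits (@petersen_transmits _ [:: 2; 0; 0] [:: 0; 1; 2; 0; 0; 2; 1; 2; 1] _)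
    (@petersen_transmits _ _ [:: 0; 1; 2; 2; 1; 0; 0; 1; 2] _); by [].
- apply: series_transmits (@petersen_transmits _ [:: 0; 0; 0] [:: 2; 1; 2; 2; 0; 2; 1; 0; 1] _)
    (@petersen_transmits _ _ [:: 2; 1; 2; 2; 1; 2; 0; 1; 0] _); by [].
- apply: series_transmits (@petersen_transmits _ [:: 1; 0; 0] [:: 0; 2; 1; 0; 0; 1; 2; 1; 2] _)
    (@petersen_transmits _ _ [:: 0; 2; 1; 1; 2; 0; 0; 2; 1] _); by [].
- apply: series_transmits (@petersen_transmits _ [:: 2; 0; 0] [:: 1; 1; 2; 0; 1; 2; 1; 2; 0] _)
    (@petersen_transmits _ _ [:: 1; 1; 2; 2; 1; 0; 1; 0; 2] _); by [].
apply: series_transmits (@petersen_transmits _ [:: 1; 0; 1] [:: 2; 1; 2; 2; 1; 2; 0; 1; 0] _)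
    (@petersen_transmits _ _ [:: 2; 1; 2; 2; 0; 2; 1; 0; 1] _); by [].
Qed.

(** * Splicing a pole into the sites of a frame *)

Lemma sum_pair (I J : finType) (F : I * J -> nat) : \sum_p F p = \sum_i \sum_j F (i, j).
Proof. by rewrite pair_bigA; apply: eq_bigr => -[]. Qed.

(* A cubic graph some of whose edges are grouped into triples, called sites;
   each triple is to be cut open and joined to the ports of a pole. *)
Record frame := Frame {
  base : finType;
  link : finType;
  site : finType;
  link_end : link * bool -> base;
  site_in : site * 'I_3 -> base;
  site_out : site * 'I_3 -> base
}.

Section Splice.
Variables (Fr : frame) (N : pole).

Definition splice_edge : Type :=
  (link Fr + (site Fr * pole_edge N + (site Fr * 'I_3 + site Fr * 'I_3)))%type.

Definition splice_end (h : splice_edge * bool) : base Fr + site Fr * pole_vertex N :=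
  match h with
  | (inl e, b) => inl (link_end (e, b))
  | (inr (inl (c, e)), b) => inr (c, pole_end (e, b))
  | (inr (inr (inl (c, j))), b) => if b then inr (c, port_in N j) else inl (site_in (c, j))
  | (inr (inr (inr (c, j))), b) => if b then inl (site_out (c, j)) else inr (c, port_out N j)
  end.

Definition splice : multigraph := Multigraph splice_end.

Definition link_edge (e : link Fr) : edge splice := inl e.
Definition inner_edge c (e : pole_edge N) : edge splice := inr (inl (c, e)).
Definition in_edge c (j : 'I_3) : edge splice := inr (inr (inl (c, j))).
Definition out_edge c (j : 'I_3) : edge splice := inr (inr (inr (c, j))).

Lemma splice_sum_base (F : edge splice * bool -> nat) u :
  vertex_sum F (inl u : vertex splice) =
  \sum_h (link_end h == u) * F (link_edge h.1, h.2)
  + \sum_c \sum_j (site_in (c, j) == u) * F (in_edge c j, false)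
  + \sum_c \sum_j (site_out (c, j) == u) * F (out_edge c j, true).
Proof.
rewrite /vertex_sum !sum_half_edges !big_sumType /= [X in _ + (X + _)]big1 => [|[c e] _ //].
rewrite add0n addnA !sum_pair; congr (_ + _ + _); apply: eq_bigr => c _; apply: eq_bigr => j _ /=.
by rewrite mul0n addn0.
Qed.

Lemma splice_sum_pole (F : edge splice -> nat) c y :
  vertex_sum (fun h => F h.1) (inr (c, y) : vertex splice) =
  pole_sum (fun e => F (inner_edge c e)) (fun j => F (in_edge c j)) (fun j => F (out_edge c j)) y.
Proof.
have at_c (J : finType) (H : site Fr -> J -> nat) (K : J -> nat) :
    (forall d j, H d j = (d == c) * K j) -> \sum_d \sum_j H d j = \sum_j K j.
  move=> HK; rewrite (bigD1 c) //= [X in _ + X]big1 ?addn0 => [|d /negPf dc].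
    by apply: eq_bigr => j _; rewrite HK eqxx mul1n.
  by apply: big1 => j _; rewrite HK dc.
have eqE d x : (inr (d, x) == inr (c, y) :> vertex splice) = (d == c) && (x == y).
  by apply/eqP/andP => [[-> ->]|[/eqP-> /eqP->]].
rewrite /vertex_sum /pole_sum !sum_half_edges !big_sumType /= [X in X + _]big1 // add0n.
rewrite !sum_pair -addnA; congr (_ + (_ + _)); apply: at_c => d e /=.
- by rewrite !eqE; case: eqP => [->|_]; rewrite /= ?mul1n ?mul0n.
- by rewrite eqE add0n; case: eqP => [->|_]; rewrite /= ?mul1n ?mul0n.
- by rewrite eqE addn0; case: eqP => [->|_]; rewrite /= ?mul1n ?mul0n.
Qed.

Section Cuts.
Variable X : vertex splice -> bool.

Definition base_part (u : base Fr) : bool := X (inl u).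
Definition pole_part c (y : pole_vertex N) : bool := X (inr (c, y)).

Definition site_cut c : nat := inner_cut (pole_part c)
  + \sum_j (base_part (site_in (c, j)) != pole_part c (port_in N j))
  + \sum_j (pole_part c (port_out N j) != base_part (site_out (c, j))).

Definition link_cut (X0 : base Fr -> bool) : nat :=
  \sum_e (X0 (link_end (e, false)) != X0 (link_end (e, true))).

(** The cut in the graph in which each site is closed up by three direct edges. *)
Definition frame_cut (X0 : base Fr -> bool) : nat :=
  link_cut X0 + \sum_c \sum_j (X0 (site_in (c, j)) != X0 (site_out (c, j))).

Lemma splice_cutE : cut X = link_cut base_part + \sum_c site_cut c.
Proof.
rewrite /cut !big_sumType /= !big_split /= !sum_pair; congr (_ + _).
by rewrite addnA.
Qed.

Lemma splice_sizeE : size_of X = size_of base_part + \sum_c size_of (pole_part c).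
Proof. by rewrite /size_of big_sumType sum_pair. Qed.

End Cuts.

(** [frame_cuts] and [frame_girth] concern the frame with its sites closed up. The last two
    conditions keep a base vertex from touching a pole on both sides or by three lanes of one
    side. *)
Record sound_frame : Prop := SoundFrame {
  frame_cubic : forall u : base Fr, \sum_h (link_end h == u)
    + \sum_c \sum_j (site_in (c, j) == u) + \sum_c \sum_j (site_out (c, j) == u) = 3;
  frame_cuts : forall X : base Fr -> bool, 1 < size_of X -> 1 < size_of (predC X) -> 4 <= frame_cut X;
  frame_girth : forall X : base Fr -> bool, 0 < size_of X <= 4 -> size_of X + 2 <= frame_cut X;
  frame_ports : forall (u : base Fr) (c : site Fr),
    \sum_j (site_in (c, j) == u) <= 2 /\ \sum_j (site_out (c, j) == u) <= 2;
  frame_sites : forall (c : site Fr) i j, site_in (c, i) != site_out (c, j)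
}.

Hypotheses (sFr : sound_frame) (sN : sound_pole N).

Lemma splice_cubic : cubic splice.
Proof.
move=> [u|[c y]]; rewrite degree_inE.
  rewrite splice_sum_base -[RHS](frame_cubic sFr u); congr (_ + _ + _);
    by [apply: eq_bigr => h _; rewrite in_setT muln1
       |apply: eq_bigr => c _; apply: eq_bigr => j _; rewrite in_setT muln1].
rewrite (splice_sum_pole (fun e => e \in setT)) -[RHS](sound_cubic sN y).
by apply: eq_pole_sum => z; rewrite in_setT.
Qed.

Section CutBound.
Variable X : vertex splice -> bool.
Let X0 := base_part X.
Let Y c := pole_part X c.

(** By [sound_linked] and the triangle inequality, a pole contributes at least as much to a cut as
    three direct edges in its place. *)
Lemma splice_cut_linked : frame_cut X0 <= cut X.
Proof.
rewrite splice_cutE leq_add2l; apply: leq_sum => c _.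
have := sound_linked sN (Y c) (fun j => X0 (site_in (c, j))).
have := neq_sum_trans (fun j => X0 (site_in (c, j))) (fun j => Y c (port_out N j))
  (fun j => X0 (site_out (c, j))).
rewrite /site_cut -/X0 /= -/(Y c); lia.
Qed.

Lemma size_of_le1 (T : finType) (Z : T -> bool) x y : size_of Z <= 1 -> Z x -> Z y -> x = y.
Proof.
rewrite size_ofE => /card_le1_eqP Z1 Zx Zy; apply: Z1; by rewrite inE.
Qed.

Lemma site_cutE c : site_cut X c
    + 2 * (\sum_j (X0 (site_in (c, j)) && Y c (port_in N j)))
    + 2 * (\sum_j (Y c (port_out N j) && X0 (site_out (c, j)))) =
  pole_cut (Y c) + \sum_j X0 (site_in (c, j)) + \sum_j X0 (site_out (c, j)).
Proof.
have := neq_sum (fun j => X0 (site_in (c, j))) (fun j => Y c (port_in N j)).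
have := neq_sum (fun j => Y c (port_out N j)) (fun j => X0 (site_out (c, j))).
rewrite /pole_cut /ins /outs /site_cut -/X0 -/(Y c) /=; lia.
Qed.

Lemma site_neq_sum c : \sum_j (X0 (site_in (c, j)) != X0 (site_out (c, j)))
  <= \sum_j X0 (site_in (c, j)) + \sum_j X0 (site_out (c, j)).
Proof.
have := neq_sum (fun j => X0 (site_in (c, j))) (fun j => X0 (site_out (c, j))).
by rewrite /=; lia.
Qed.

Lemma site_exclusive c : size_of X0 <= 1 ->
  \sum_j X0 (site_in (c, j)) = 0 \/ \sum_j X0 (site_out (c, j)) = 0.
Proof.
move=> X1; case: (pickP (fun j => X0 (site_in (c, j)))) => [i Xi|X0i]; last first.
  by left; apply: big1 => j _; rewrite X0i.
right; apply: big1 => j _; case Xj: (X0 _) => //.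
by have := frame_sites sFr c i j; rewrite (size_of_le1 X1 Xi Xj) eqxx.
Qed.

Lemma site_ports_le2 c : size_of X0 <= 1 ->
  \sum_j X0 (site_in (c, j)) <= 2 /\ \sum_j X0 (site_out (c, j)) <= 2.
Proof.
move=> X1; case: (pickP X0) => [u Xu|X00]; last by split; rewrite big1 // => j _; rewrite X00.
have [le_in le_out] := frame_ports sFr u c.
split; [apply: leq_trans le_in|apply: leq_trans le_out];
  apply: leq_sum => j _; case Xj: (X0 _) => //; by rewrite (size_of_le1 X1 Xj Xu) eqxx.
Qed.

(** A lane inside [X] saves 2. The base vertex touches one side only, by at most two lanes: one
    shared lane saves 2 from a pole cut of at least 3; two save 4, but then [sound_ports] gives at
    least 5. *)
Lemma site_cut_small_base c : size_of X0 <= 1 ->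
  \sum_j (X0 (site_in (c, j)) != X0 (site_out (c, j))) + (0 < size_of (Y c)) <= site_cut X c.
Proof.
move=> X1; have := site_cutE c; have := site_neq_sum c.
have := site_exclusive c X1; have := site_ports_le2 c X1.
have := and_suml (fun j => X0 (site_in (c, j))) (fun j => Y c (port_in N j)).
have := and_sumr (fun j => X0 (site_in (c, j))) (fun j => Y c (port_in N j)).
have := and_suml (fun j => Y c (port_out N j)) (fun j => X0 (site_out (c, j))).
have := and_sumr (fun j => Y c (port_out N j)) (fun j => X0 (site_out (c, j))).
have := sound_cut sN (Y c); have := sound_ports sN (Y c); have := no_ports (X := Y c).
rewrite /ins /outs /=; lia.
Qed.

(** With three vertices in the pole there is one base vertex, which touches one side only, and
    [sound_girth3] applies. With at most two, [sound_girth2] is compared with the base lane by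
    lane. *)
Lemma site_cut_girth c : 0 < size_of X0 -> size_of X0 + size_of (Y c) <= 4 ->
  \sum_j (X0 (site_in (c, j)) != X0 (site_out (c, j))) + size_of (Y c) <= site_cut X c.
Proof.
move=> X1 XY4; have := site_cutE c.
have := neq_sum (fun j => X0 (site_in (c, j))) (fun j => X0 (site_out (c, j))).
have [Y3|Y2] : size_of (Y c) = 3 \/ size_of (Y c) <= 2 by lia.
  have := site_exclusive c; have := sound_girth3 sN (X := Y c).
  have := and_suml (fun j => X0 (site_in (c, j))) (fun j => Y c (port_in N j)).
  have := and_sumr (fun j => X0 (site_in (c, j))) (fun j => Y c (port_in N j)).
  have := and_suml (fun j => Y c (port_out N j)) (fun j => X0 (site_out (c, j))).
  have := and_sumr (fun j => Y c (port_out N j)) (fun j => X0 (site_out (c, j))).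
  have := and_suml (fun j => X0 (site_in (c, j))) (fun j => X0 (site_out (c, j))).
  have := and_sumr (fun j => X0 (site_in (c, j))) (fun j => X0 (site_out (c, j))).
  rewrite /ins /outs /=; lia.
have := sound_girth2 sN Y2.
suff : \sum_j (X0 (site_in (c, j)) && Y c (port_in N j))
    + \sum_j (Y c (port_out N j) && X0 (site_out (c, j)))
  <= \sum_j (Y c (port_in N j) || Y c (port_out N j))
    + \sum_j (X0 (site_in (c, j)) && X0 (site_out (c, j))) by rewrite /=; lia.
rewrite -!big_split; apply: leq_sum => j _ /=.
by case: (X0 _) (X0 _) (Y c _) (Y c _) => -[] [] [].
Qed.

(** Without base vertices the pole cuts add up: two vertices in one pole give 4, vertices in two
    poles 3 + 3. With one base vertex the frame gives 3 and a pole that is met adds 1. *)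
Lemma splice_cut_small_base : size_of X0 <= 1 -> 1 < size_of X -> 4 <= cut X.
Proof.
move=> X1; rewrite splice_sizeE -/X0 => sX.
have [X00|X01] : size_of X0 = 0 \/ size_of X0 = 1 by lia.
  have cutY c : site_cut X c = pole_cut (Y c).
    have := site_cutE c; rewrite ![\sum_j X0 _]big1 ?[\sum_j (X0 _ && _)]big1 ?[\sum_j (_ && X0 _)]big1;
      try by move=> j _; rewrite (size_of_eq0 X00) ?andbF.
    by lia.
  apply: leq_trans (_ : \sum_c pole_cut (Y c) <= _); last first.
    by rewrite splice_cutE -(eq_bigr _ (fun c _ => cutY c)) leq_addl.
  rewrite X00 add0n in sX.
  have [c Yc] : exists c, 0 < size_of (Y c).
    apply/existsP; apply: contraLR sX; rewrite negb_exists => /forallP Y0.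
    by rewrite big1 // => c _; apply/eqP; rewrite -leqn0 leqNgt Y0.
  rewrite (bigD1 c) //= -/(Y c) in sX; rewrite (bigD1 c) //=.
  have [Yc2|Yc1] := ltnP 1 (size_of (Y c)).
    by apply: leq_trans (proj2 (sound_cut sN (Y c)) Yc2) _; rewrite leq_addr.
  have [d /andP[dc Yd]] : exists d, (d != c) && (0 < size_of (Y d)).
    apply/existsP; apply: contraLR sX; rewrite negb_exists => /forallP Y0.
    rewrite [X in _ + X]big1 => [|d dc]; first by lia.
    by have := Y0 d; rewrite dc -/(Y d); lia.
  rewrite (bigD1 d) //=.
  have := proj1 (sound_cut sN (Y c)) Yc; have := proj1 (sound_cut sN (Y d)) Yd; lia.
have := frame_girth sFr (X := X0); rewrite X01 => /(_ isT) cut0.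
suff : frame_cut X0 + 1 <= cut X by lia.
rewrite splice_cutE /frame_cut -addnA leq_add2l.
have [c Yc] : exists c, 0 < size_of (Y c).
  apply/existsP; apply: contraLR sX; rewrite negb_exists X01 => /forallP Y0.
  by rewrite big1 // => c _; apply/eqP; rewrite -leqn0 leqNgt Y0.
rewrite (bigD1 c) // [X in _ <= X](bigD1 c) //= addnAC.
apply: leq_add; first by have := site_cut_small_base c X1; rewrite Yc.
by apply: leq_sum => d _; apply: leq_trans (site_cut_small_base d X1); apply: leq_addr.
Qed.

Lemma splice_girth : 0 < size_of X <= 4 -> size_of X + 2 <= cut X.
Proof.
rewrite splice_sizeE -/X0 => sX.
have leY c : size_of (Y c) <= \sum_c size_of (pole_part X c) by rewrite (bigD1 c) //= leq_addr.
have [X00|X01] : size_of X0 = 0 \/ 0 < size_of X0 by lia.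
  have cutY c : site_cut X c = pole_cut (Y c).
    have := site_cutE c; rewrite ![\sum_j X0 _]big1 ?[\sum_j (X0 _ && _)]big1 ?[\sum_j (_ && X0 _)]big1;
      try by move=> j _; rewrite (size_of_eq0 X00) ?andbF.
    by lia.
  apply: leq_trans (_ : \sum_c pole_cut (Y c) <= _); last first.
    by rewrite splice_cutE -(eq_bigr _ (fun c _ => cutY c)) leq_addl.
  rewrite X00 add0n in sX *.
  have [c Yc] : exists c, 0 < size_of (Y c).
    apply/existsP; case/andP: sX => sX _; apply: contraLR sX; rewrite negb_exists => /forallP Y0.
    by rewrite big1 // => c _; apply/eqP; rewrite -leqn0 leqNgt Y0.
  rewrite (bigD1 c) // [X in _ <= X](bigD1 c) //= addnAC; apply: leq_add.
    apply: (sound_girth sN); apply/andP; split=> //.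
    by apply: leq_trans (leY c) _; case/andP: sX.
  apply: leq_sum => d _; have := sound_girth sN (X := Y d); have := leY d.
  rewrite -/(Y d); lia.
have := frame_girth sFr (X := X0).
suff : frame_cut X0 + \sum_c size_of (pole_part X c) <= cut X by lia.
rewrite splice_cutE /frame_cut -addnA leq_add2l -big_split.
apply: leq_sum => c _; apply: site_cut_girth => //.
by apply: leq_trans (leq_add (leqnn _) (leY c)) _; case/andP: sX.
Qed.

End CutBound.

Lemma splice_cuts X : 1 < size_of X -> 1 < size_of (predC X) -> 4 <= cut (G := splice) X.
Proof.
move=> X1 nX1.
have [small|big] := leqP (size_of (base_part X)) 1; first exact: splice_cut_small_base.
have [nsmall|nbig] := leqP (size_of (predC (base_part X))) 1.
  by rewrite -cutC; apply: splice_cut_small_base.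
by apply: leq_trans (frame_cuts sFr big nbig) _; apply: splice_cut_linked.
Qed.

End Splice.

(** * The frame derived from the Petersen graph *)

Lemma sum_grid m k (F : nat -> nat) :
  \sum_(c < m) \sum_(j < k) F (c * k + j) = \sum_(i <- iota 0 (m * k)) F i.
Proof.
elim: m => [|m IHm]; first by rewrite big_ord0 big_nil.
rewrite big_ord_recr IHm mulSn addnC iotaD big_cat; congr (_ + _).
rewrite -(big_mkord xpredT (fun j => F (m * k + j))) /index_iota subn0.
by rewrite -(big_map (addn (m * k)) xpredT) -iotaDl addn0.
Qed.

Lemma sum_zip_iota m (l : seq nat) (G : nat -> nat) v :
  \sum_(p <- zip l (iota m (size l))) (p.1 == v) * G p.2 =
  \sum_(i <- iota 0 (size l)) (nth 0 l i == v) * G (m + i).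
Proof.
rewrite (big_nth (0, 0)) size_zip size_iota minnn /index_iota subn0.
apply: eq_big_seq => i; rewrite mem_iota => /= lt_i.
by rewrite nth_zip ?size_iota //= nth_iota.
Qed.

(* Vertices 6i, ..., 6i + 5: a vertex of the pentagon, the two vertices that widen
   its spoke to three lanes, and three vertices in the place of the inner vertex. *)
Definition frame_links : seq (nat * nat) :=
  [seq (6 * i, 6 * ((i + 2) %% 5)) | i <- iota 0 5]
  ++ [seq (6 * i, 6 * i + 1) | i <- iota 0 5]
  ++ [seq (6 * i + 1, 6 * i + 2) | i <- iota 0 5].

Definition frame_lanes : seq (nat * nat) :=
  flatten [seq [:: (6 * i + 1, 6 * i + 3); (6 * i + 2, 6 * i + 4); (6 * i + 2, 6 * i + 5)]
    | i <- iota 0 5]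
  ++ flatten [seq [seq (6 * i + 3 + j, 6 * ((i + 1) %% 5) + 3 + j) | j <- iota 0 3] | i <- iota 0 5].

Definition lane_end (b : bool) (p : 'I_10 * 'I_3) : 'I_30 :=
  list_end 29 frame_lanes (p.1 * 3 + p.2) b.

Definition petersen_frame : frame :=
  @Frame 'I_30 'I_15 'I_10 (fun h => list_end 29 frame_links h.1 h.2)
    (lane_end false) (lane_end true).

Definition frame_edges : seq (nat * nat) := Eval vm_compute in frame_links ++ frame_lanes.

Lemma frame_cutE (X : 'I_30 -> bool) :
  frame_cut (Fr := petersen_frame) X = bit_cut (bits X) frame_edges.
Proof.
rewrite -[frame_edges]/(frame_links ++ frame_lanes) /bit_cut map_cat sumn_cat.
rewrite -!/(bit_cut _ _) /frame_cut; congr (_ + _); first exact: bit_cutE.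
rewrite -(@bit_cutE 29 30) //.
pose G i : nat := X (list_end 29 frame_lanes i false) != X (list_end 29 frame_lanes i true).
rewrite -[LHS]/(\sum_(c < 10) \sum_(j < 3) G (c * 3 + j)) sum_grid.
by rewrite -[iota 0 _]/(index_iota 0 30) big_mkord.
Qed.

(** Counts only edges between vertices already decided, so it grows with the prefix and can prune
    the search through the 2^30 subsets. *)
Definition partial_cut (s : seq bool) (l : seq (nat * nat)) : nat :=
  count (fun p => [&& p.1 < size s, p.2 < size s & nth false s p.1 != nth false s p.2]) l.

Lemma partial_cut_take s l i : partial_cut (take i s) l <= partial_cut s l.
Proof.
apply: sub_count => p /=; rewrite size_take_min !ltn_min.
by case/and3P=> /andP[i1 s1] /andP[i2 s2]; rewrite !nth_take // s1 s2.
Qed.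

Lemma partial_cut_le s l : partial_cut s l <= bit_cut s l.
Proof.
rewrite /bit_cut /partial_cut sumn_map -sum1_count [leqLHS]big_mkcond; apply: leq_sum => p _.
by case: ifP => // /and3P[_ _ ->].
Qed.

Lemma count_take (T : Type) (a : pred T) s i : count a (take i s) <= count a s.
Proof. by rewrite -{2}(cat_take_drop i s) count_cat leq_addr. Qed.

Lemma frame_cut_search : search [:: true; false] (fun s => partial_cut s frame_edges <= 3)
  (fun s => (count id s <= 1) || (count negb s <= 1)) 30 [::].
Proof. by vm_compute. Qed.

(** A counterexample has at most 4 vertices and a cut smaller than its size plus 2, hence at most 5;
    both bounds prune. *)
Lemma frame_girth_search : search [:: true; false]
  (fun s => (count id s <= 4) && (partial_cut s frame_edges <= 5))
  (fun s => (count id s == 0) || (count id s + 2 <= bit_cut s frame_edges)) 30 [::].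
Proof. by vm_compute. Qed.

Lemma sub_bits n (X : 'I_n.+1 -> bool) : {subset bits X <= [:: true; false]}.
Proof. by case; rewrite !inE. Qed.

(* Slots 0-29 are the half-edges of the links, 30-59 and 60-89 the site ends. *)
Definition frame_incidences : seq (nat * nat) :=
  zip (unzip1 frame_links) (iota 0 15) ++ zip (unzip2 frame_links) (iota 15 15)
    ++ zip (unzip1 frame_lanes) (iota 30 30) ++ zip (unzip2 frame_lanes) (iota 60 30).

Definition frame_slots : seq (seq nat) :=
  Eval vm_compute in [seq slots_at frame_incidences u | u <- iota 0 30].

Lemma frame_slotsE u : u < 30 -> slots_at frame_incidences u = nth [::] frame_slots u.
Proof.
rewrite (_ : frame_slots = [seq slots_at frame_incidences u | u <- iota 0 30]) // => lt_u.
have lt_us : u < size (iota 0 30) by rewrite size_iota.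
by rewrite (nth_map 0 _ _ lt_us) nth_iota ?add0n.
Qed.

Definition frame_slot (T : Type) (f : 'I_15 * bool -> T) (l r : 'I_10 -> 'I_3 -> T) (i : nat) : T :=
  if i < 15 then f (inord i, false) else
  if i < 30 then f (inord (i - 15), true) else
  if i < 60 then l (inord ((i - 30) %/ 3)) (inord ((i - 30) %% 3))
  else r (inord ((i - 60) %/ 3)) (inord ((i - 60) %% 3)).

Section FrameSlots.
Variables (T : Type) (f : 'I_15 * bool -> T) (l r : 'I_10 -> 'I_3 -> T).

Lemma frame_slot_first i : i < 15 -> frame_slot f l r i = f (inord i, false).
Proof. by rewrite /frame_slot => ->. Qed.

Lemma frame_slot_second i : i < 15 -> frame_slot f l r (15 + i) = f (inord i, true).
Proof.
move=> lt_i; rewrite /frame_slot addKn.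
by case: ltnP => ?; [lia|case: ltnP => ?; [|lia]].
Qed.

Lemma frame_slot_in i : i < 30 ->
  frame_slot f l r (30 + i) = l (inord (i %/ 3)) (inord (i %% 3)).
Proof.
move=> lt_i; rewrite /frame_slot addKn.
by case: ltnP => ?; [lia|case: ltnP => ?; [lia|case: ltnP => ?; [|lia]]].
Qed.

Lemma frame_slot_out i : i < 30 ->
  frame_slot f l r (60 + i) = r (inord (i %/ 3)) (inord (i %% 3)).
Proof.
move=> lt_i; rewrite /frame_slot addKn.
by case: ltnP => ?; [lia|case: ltnP => ?; [lia|case: ltnP => ?; [lia|]]].
Qed.

End FrameSlots.

Lemma list_end_eq n l i b (u : 'I_n.+1) : all (gtn n.+1) (unzip1 l ++ unzip2 l) ->
  (list_end n l i b == u) = (nth 0 (if b then unzip2 l else unzip1 l) i == u :> nat).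
Proof.
rewrite all_cat => /andP[/allP lt1 /allP lt2]; rewrite /list_end.
have [lt_i|le_i] := ltnP i (size l); last first.
  by rewrite !(nth_default _ le_i) nth_default ?inord_eq //; case: b; rewrite ?size_map.
case: b; rewrite inord_eq ?(nth_map (0, 0)) //.
  by apply: lt2; rewrite map_f ?mem_nth.
by apply: lt1; rewrite map_f ?mem_nth.
Qed.

Lemma frame_sumE f l r (u : 'I_30) :
  \sum_h (link_end (f := petersen_frame) h == u) * f h
    + \sum_c \sum_j (site_in (f := petersen_frame) (c, j) == u) * l c j
    + \sum_c \sum_j (site_out (f := petersen_frame) (c, j) == u) * r c j =
  \sum_(i <- slots_at frame_incidences u) frame_slot f l r i.
Proof.
have laneE b (t : 'I_10 -> 'I_3 -> nat) :
    \sum_c \sum_j (lane_end b (c, j) == u) * t c j =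
    \sum_(i <- iota 0 30) (nth 0 (if b then unzip2 frame_lanes else unzip1 frame_lanes) i == u)
      * t (inord (i %/ 3)) (inord (i %% 3)).
  rewrite -(@sum_grid 10 3 (fun i => (nth 0 (if b then unzip2 frame_lanes else unzip1 frame_lanes) i == u)
      * t (inord (i %/ 3)) (inord (i %% 3)))).
  apply: eq_bigr => c _; apply: eq_bigr => j _.
  by rewrite /lane_end list_end_eq // divnMDl // divn_small // addn0 modnMDl modn_small // !inord_val.
rewrite -(sum_delta _ _ (u : nat)) !big_cat !laneE sum_half_edges big_split -!addnA.
have linkE b : \sum_(e < 15) (list_end 29 frame_links e b == u) * f (e, b) =
    \sum_(i <- iota 0 15) (nth 0 (if b then unzip2 frame_links else unzip1 frame_links) i == u)
      * f (inord i, b).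
  rewrite sum_ord_iota; apply: eq_big_seq => i; rewrite mem_iota => /andP[_ lt_i].
  by rewrite list_end_eq // inordK.
rewrite !linkE.
congr (_ + (_ + (_ + _))).
- rewrite (sum_zip_iota 0 (unzip1 frame_links)); apply: eq_big_seq => i.
  by rewrite mem_iota => /andP[_ lt_i]; rewrite frame_slot_first.
- rewrite (sum_zip_iota 15 (unzip2 frame_links)); apply: eq_big_seq => i.
  by rewrite mem_iota => /andP[_ lt_i]; rewrite frame_slot_second.
- rewrite (sum_zip_iota 30 (unzip1 frame_lanes)); apply: eq_big_seq => i.
  by rewrite mem_iota => /andP[_ lt_i]; rewrite frame_slot_in.
rewrite (sum_zip_iota 60 (unzip2 frame_lanes)); apply: eq_big_seq => i.
by rewrite mem_iota => /andP[_ lt_i]; rewrite frame_slot_out.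
Qed.

Lemma frame_bit_cuts (X : 'I_30 -> bool) :
  1 < size_of X -> 1 < size_of (predC X) -> 4 <= bit_cut (bits X) frame_edges.
Proof.
have -> : size_of (predC X) = count negb (bits X) by rewrite size_of_bits !count_map.
rewrite size_of_bits => X1 nX1; rewrite leqNgt; apply/negP => cut3.
have pre i : partial_cut (take i (bits X)) frame_edges <= 3.
  exact: leq_trans (partial_cut_take _ _ _) (leq_trans (partial_cut_le _ _) cut3).
have := searchP frame_cut_search (size_mkseq _ _) (@sub_bits 29 X) pre.
by case/orP; rewrite leqNgt ?X1 ?nX1.
Qed.

Lemma frame_bit_girth (X : 'I_30 -> bool) :
  0 < size_of X <= 4 -> size_of X + 2 <= bit_cut (bits X) frame_edges.
Proof.
rewrite size_of_bits => /andP[X0 X4]; rewrite leqNgt; apply/negP => cut5.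
have pre i : (count id (take i (bits X)) <= 4) && (partial_cut (take i (bits X)) frame_edges <= 5).
  rewrite (leq_trans (count_take _ _ _) X4) /=.
  have cut_le5 : bit_cut (bits X) frame_edges <= 5 by lia.
  exact: leq_trans (partial_cut_take _ _ _) (leq_trans (partial_cut_le _ _) cut_le5).
have := searchP frame_girth_search (size_mkseq _ _) (@sub_bits 29 X) pre.
by rewrite eqn0Ngt X0 leqNgt cut5.
Qed.

Lemma lane_ports : all (fun u => all (fun c =>
    (sumn [seq nat_of_bool (nth 0 (unzip1 frame_lanes) (c * 3 + j) == u) | j <- iota 0 3] <= 2)
    && (sumn [seq nat_of_bool (nth 0 (unzip2 frame_lanes) (c * 3 + j) == u) | j <- iota 0 3] <= 2))
  (iota 0 10)) (iota 0 30).
Proof. by vm_compute. Qed.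

Lemma lane_ends_distinct : all (fun c => all (fun i => all (fun j =>
    nth 0 (unzip1 frame_lanes) (c * 3 + i) != nth 0 (unzip2 frame_lanes) (c * 3 + j))
  (iota 0 3)) (iota 0 3)) (iota 0 10).
Proof. by vm_compute. Qed.

Lemma sound_petersen_frame : sound_frame petersen_frame.
Proof.
split.
- move=> u; have := frame_sumE (fun=> 1) (fun _ _ => 1) (fun _ _ => 1) u.
  have -> : \sum_(i <- slots_at frame_incidences u) frame_slot (fun=> 1) (fun _ _ => 1) (fun _ _ => 1) i = 3.
    have /allP/(_ _ (mem_nth [::] (ltn_ord u : u < size frame_slots)))/eqP sz :
      all (fun s => size s == 3) frame_slots by [].
    rewrite frame_slotsE // -[RHS]sz -sum1_size; apply: eq_bigr => i _; rewrite /frame_slot.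
    by case: (i < 15); case: (i < 30); case: (i < 60).
  move=> sum3; rewrite -[RHS]sum3; congr (_ + _ + _);
    by [apply: eq_bigr => h _; rewrite muln1
       |apply: eq_bigr => c _; apply: eq_bigr => j _; rewrite muln1].
- by move=> X X1 nX1; rewrite frame_cutE; apply: frame_bit_cuts.
- by move=> X X14; rewrite frame_cutE; apply: frame_bit_girth.
- move=> u c; have := lane_ports; move=> /allP/(_ (u : nat)).
  rewrite mem_iota ltn_ord => /(_ isT)/allP/(_ (c : nat)).
  rewrite mem_iota ltn_ord => /(_ isT); rewrite !sumn_map.
  rewrite -[iota 0 3]/(index_iota 0 3) !big_mkord => /andP[le_in le_out].
  split; [apply: leq_trans le_in|apply: leq_trans le_out]; apply: leq_sum => j _.
    by rewrite -[site_in _]/(lane_end false (c, j)) /lane_end list_end_eq.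
  by rewrite -[site_out _]/(lane_end true (c, j)) /lane_end list_end_eq.
move=> c i j; apply/negP => /eqP eq_ij; have := lane_ends_distinct.
move=> /allP/(_ (c : nat)); rewrite mem_iota ltn_ord => /(_ isT)/allP/(_ (i : nat)).
rewrite mem_iota ltn_ord => /(_ isT)/allP/(_ (j : nat)).
rewrite mem_iota ltn_ord => /(_ isT)/negP; apply.
set u := lane_end true (c, j).
have := list_end_eq (l := frame_lanes) (c * 3 + i) false u isT.
have := list_end_eq (l := frame_lanes) (c * 3 + j) true u isT.
rewrite -[list_end _ _ _ false]/(lane_end false (c, i)) -[list_end _ _ _ true]/u eqxx.
rewrite [lane_end false _]eq_ij eqxx.
by move=> /esym/eqP-> /esym/eqP->.
Qed.

(** * Inflating one vertex *)

Section Inflation.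
Variables (G : multigraph) (v : vertex G) (attach : edge G * bool -> 'I_3).
Notation H := (inflate v attach).

Lemma inflate_endpoint_inl (h : edge G * bool) (u : {u : vertex G | u != v}) :
  (inflate_endpoint v attach (inl h.1, h.2) == inl u) = (endpoint h == val u).
Proof.
case: h => e b /=; case: insubP => [w _ <-|]; first by [].
rewrite negbK => /eqP ->; apply/esym/negP => /eqP vu.
by have /negP := valP u; apply; apply/eqP/esym.
Qed.

Lemma inflate_endpoint_inr (h : edge G * bool) i :
  (inflate_endpoint v attach (inl h.1, h.2) == inr i :> vertex H) = (endpoint h == v) && (attach h == i).
Proof.
case: h => e b /=; case: insubP => [w /negPf-> //|].
by rewrite negbK => ->.
Qed.

Lemma ordS_eq (i j : 'I_3) : (ordS i == j) = (i == ord_pred j).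
Proof. by apply/eqP/eqP => [<-|->]; rewrite ?ord_predK ?ordSK. Qed.

Lemma inflate_sum_inl (F : edge H * bool -> nat) u :
  vertex_sum F (inl u : vertex H) = vertex_sum (fun h => F (inl h.1, h.2)) (val u).
Proof.
rewrite /vertex_sum !sum_half_edges big_sumType /= [X in _ + X]big1 ?addn0 => [|i _ //].
apply: eq_bigr => e _.
by rewrite (inflate_endpoint_inl (e, false)) (inflate_endpoint_inl (e, true)).
Qed.

(** Triangle vertex [i] is the first end of triangle edge [i] and the second end of the preceding
    one. *)
Lemma inflate_sum_inr (F : edge H * bool -> nat) i :
  vertex_sum F (inr i : vertex H) =
  vertex_sum (fun h => (attach h == i) * F (inl h.1, h.2)) v
    + (F (inr i, false) + F (inr (ord_pred i), true)).
Proof.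
rewrite /vertex_sum !sum_half_edges big_sumType /=; congr (_ + _).
  apply: eq_bigr => e _.
  rewrite (inflate_endpoint_inr (e, false)) (inflate_endpoint_inr (e, true)).
  by rewrite -!mulnb !mulnA.
rewrite big_split /=; congr (_ + _).
  rewrite (bigD1 i) //= eqxx mul1n big1 ?addn0 // => j /negPf ji.
  by rewrite (_ : (inr j == inr i) = (j == i)) // ji.
rewrite (bigD1 (ord_pred i)) //= ord_predK eqxx mul1n big1 ?addn0 // => j /negPf ji.
by rewrite (_ : (inr (ordS j) == inr i) = (ordS j == i)) // ordS_eq ji.
Qed.

(** If [X] splits the triangle, two of its edges are cut. Otherwise contracting the triangle turns
    [X] into a set [X0] of [G] with no larger cut. *)
Lemma inflate_cuts :
  (forall (X : vertex G -> bool) u w, X u -> ~~ X w -> 2 <= cut X) ->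
  forall (X : vertex H -> bool) u w, X u -> ~~ X w -> 2 <= cut X.
Proof.
move=> cutG X u w Xu Xw; rewrite /cut big_sumType /=.
have [/forallP same|] := boolP [forall i, X (inr i) == X (inr ord0)]; last first.
  rewrite negb_forall => /existsP[i Xi]; apply: leq_trans (leq_addl _ _).
  rewrite !big_ord_recl big_ord0 /= => {w Xw u Xu}.
  have -> : ordS (@ord0 2) = lift ord0 ord0 by apply: val_inj.
  have -> : ordS (lift ord0 (@ord0 1)) = lift ord0 (lift ord0 ord0) by apply: val_inj.
  have -> : ordS (lift ord0 (lift ord0 (@ord0 0))) = ord0 by apply: val_inj.
  have : i \in [:: ord0; lift ord0 ord0; lift ord0 (lift ord0 ord0)] by case: i {Xi} => -[|[|[|]]].
  rewrite !inE => /or3P[] /eqP ei; move: Xi; rewrite ei;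
    by case: (X _) (X _) (X _) => -[] [].
pose X0 z := if insub z is Some z then X (inl z) else X (inr ord0).
have X0E h : X (inflate_endpoint v attach (inl h.1, h.2)) = X0 (endpoint h).
  by case: h => e b; rewrite /X0 /=; case: insubP => // _; apply/eqP.
pose down (z : vertex H) := match z with inl z => val z | inr _ => v end.
have X0d z : X0 (down z) = X z.
  case: z => [z|i]; rewrite /X0 /down; first by rewrite valK.
  by rewrite insubN ?negbK //; apply/esym/eqP.
have := cutG X0 (down u) (down w); rewrite !X0d => /(_ Xu Xw) cut0.
apply: leq_trans cut0 (leq_trans _ (leq_addr _ _)).
apply: leq_sum => e _; have := X0E (e, false); have := X0E (e, true) => /= -> ->.
by [].
Qed.

End Inflation.

(** * Lower bounds on the number of uncovered edges *)

Definition single (c : cover3) : bool := c.1.1 + c.1.2 + c.2 == 1.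

(* [r] and the result are the colours of consecutive edges of the inner pentagon,
   [s] that of the spoke at their common end. *)
Definition ring_step (r s : cover3) : cover3 :=
  (~~ (r.1.1 (+) s.1.1), ~~ (r.1.2 (+) s.1.2), ~~ (r.2 (+) s.2)).

(* Whether the colours of the five spokes extend to the inner pentagon of the
   Petersen graph. *)
Definition ring_check (s : seq cover3) : bool :=
  all single s && has (fun r => all single (scanl ring_step r s) && (foldl ring_step r s == r)) covers.

Section LowerBound.
Variable n : nat.
Notation G := (splice petersen_frame (chain n)).

(** Indices 0-4 give the edges of the outer pentagon, 5-9 its spokes. *)
Definition base_half (i : nat) : edge G * bool :=
  frame_slot (fun h => (link_edge (Fr := petersen_frame) _ h.1, h.2))
    (fun c j => (in_edge (Fr := petersen_frame) _ c j, false))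
    (fun c j => (out_edge (Fr := petersen_frame) _ c j, true)) i.

Lemma base_sumE (F : edge G * bool -> nat) (u : 'I_30) :
  vertex_sum F (inl u : vertex G) = \sum_(i <- nth [::] frame_slots u) F (base_half i).
Proof.
rewrite splice_sum_base -frame_slotsE //.
rewrite (@frame_sumE (fun h => F (link_edge _ h.1, h.2)) (fun c j => F (in_edge _ c j, false))
  (fun c j => F (out_edge _ c j, true)) u).
apply: eq_bigr => i _; rewrite /base_half /frame_slot.
by case: (i < 15); case: (i < 30); case: (i < 60).
Qed.

Lemma base_half_link i : i < 15 -> (base_half (15 + i)).1 = (base_half i).1.
Proof.
by move=> lt_i; rewrite /base_half (frame_slot_second _ _ _ lt_i) (frame_slot_first _ _ _ lt_i).
Qed.

Lemma base_half_in c j : c < 10 -> j < 3 ->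
  base_half (30 + (c * 3 + j)) = (in_edge (Fr := petersen_frame) _ (inord c) (inord j), false).
Proof.
move=> lt_c lt_j; have lt_cj : c * 3 + j < 30 by lia.
rewrite /base_half (frame_slot_in _ _ _ lt_cj) divnMDl // (divn_small lt_j) addn0.
by rewrite modnMDl (modn_small lt_j).
Qed.

Lemma base_half_out c j : c < 10 -> j < 3 ->
  base_half (60 + (c * 3 + j)) = (out_edge (Fr := petersen_frame) _ (inord c) (inord j), true).
Proof.
move=> lt_c lt_j; have lt_cj : c * 3 + j < 30 by lia.
rewrite /base_half (frame_slot_out _ _ _ lt_cj) divnMDl // (divn_small lt_j) addn0.
by rewrite modnMDl (modn_small lt_j).
Qed.

Lemma frame_slots_spoke : all (fun i =>
  [&& perm_eq (nth [::] frame_slots (6 * i + 1)) [:: 15 + (5 + i); 10 + i; 30 + (i * 3 + 0)],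
      perm_eq (nth [::] frame_slots (6 * i + 2)) [:: 15 + (10 + i); 30 + (i * 3 + 1); 30 + (i * 3 + 2)] &
      all (fun j => perm_eq (nth [::] frame_slots (6 * i + (3 + j)))
        [:: 60 + (i * 3 + j); 30 + ((5 + i) * 3 + j); 60 + ((5 + (i + 4) %% 5) * 3 + j)]) (iota 0 3)])
  (iota 0 5).
Proof. by vm_compute. Qed.

Variable M : 'I_3 -> edge G -> bool.
(** The pentagon vertices are excluded so that the section serves both the snark and its inflation
    at one of them. *)
Hypothesis Mvertex : forall k w, (forall i : 'I_5, w != inl (inord (6 * i))) ->
  vertex_sum (fun h => M k h.1) w = 1.
Hypothesis few : \sum_e missed M e < n.

Definition base_cover (i : nat) : cover3 := cover_of (fun k => M k (base_half i).1).
Definition site_parity (c : nat) (k : 'I_3) : bool :=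
  odd (\sum_j M k (in_edge (Fr := petersen_frame) _ (inord c) j)).

Lemma site_matchings c : pole_matchings (N := chain n)
  (fun k e => M k (inner_edge (Fr := petersen_frame) c e))
  (fun k j => M k (in_edge _ c j)) (fun k j => M k (out_edge _ c j)).
Proof.
move=> k y; have := Mvertex k (w := inr (c, y)) (fun _ => isT).
by rewrite (splice_sum_pole (Fr := petersen_frame) (fun e => M k e)).
Qed.

Lemma sum_missed_site (d : 'I_10) :
  2 * (\sum_e missed (fun k e => M k (inner_edge (Fr := petersen_frame) d e)) e)
    + \sum_j missed (fun k j => M k (in_edge (Fr := petersen_frame) _ d j)) j
    + \sum_j missed (fun k j => M k (out_edge (Fr := petersen_frame) _ d j)) j
  <= 2 * \sum_e missed M e.
Proof.
have le_d (J : finType) (K : 'I_10 -> J -> nat) : \sum_j K d j <= \sum_c \sum_j K c j.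
  by rewrite [leqRHS](bigD1 d) //= leq_addr.
have total : \sum_e missed M e = \sum_e missed M (link_edge (Fr := petersen_frame) _ e)
    + (\sum_c \sum_e missed M (inner_edge (Fr := petersen_frame) c e)
      + (\sum_c \sum_j missed M (in_edge (Fr := petersen_frame) _ c j)
        + \sum_c \sum_j missed M (out_edge (Fr := petersen_frame) _ c j))).
  by rewrite !big_sumType !sum_pair.
have := le_d _ (fun c e => missed M (inner_edge (Fr := petersen_frame) c e)).
have := le_d _ (fun c j => missed M (in_edge (Fr := petersen_frame) _ c j)).
have := le_d _ (fun c j => missed M (out_edge (Fr := petersen_frame) _ c j)).
rewrite total {total}.
move: (\sum_c \sum_e _) (\sum_c \sum_j _) (\sum_c \sum_j _) => z y x out_le in_le e_le.
move: (\sum_e missed M (link_edge _ e)) => w.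
rewrite mulnDr !mulnDr.
apply: leq_trans (leq_add (leq_add (leq_mul (leqnn 2) e_le) in_le) out_le) _; lia.
Qed.

(** Fewer than [n] missed edges give a count below 2n, within the robustness 2(n + 1) of a chain. *)
Lemma site_parity_single c : \sum_k site_parity c k = 1.
Proof.
apply: (chain_robust (site_matchings (inord c))); apply: leq_ltn_trans (sum_missed_site _) _.
lia.
Qed.

Lemma site_parity_out c k :
  odd (\sum_j M k (out_edge (Fr := petersen_frame) _ (inord c) j)) = site_parity c k.
Proof. by rewrite -(pole_parity (chain_sound n) (site_matchings (inord c))). Qed.

Lemma base_vertex_sum u k l : u < 30 -> u %% 6 != 0 -> perm_eq (nth [::] frame_slots u) l ->
  \sum_(i <- l) M k (base_half i).1 = 1.
Proof.
move=> lt_u u6 /(perm_big _) <-.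
have := base_sumE (fun h => M k h.1) (inord u); rewrite inordK // => <-.
apply: Mvertex => i; apply: contra u6 => /eqP[] eq_u.
have := congr1 (@nat_of_ord 30) eq_u; rewrite !inordK // => [->|].
  by rewrite modnMr.
by have := ltn_ord i; lia.
Qed.

Lemma site_parity_in_half c k : c < 10 -> site_parity c k =
  odd (\sum_(j <- iota 0 3) M k (base_half (30 + (c * 3 + j))).1).
Proof.
move=> lt_c; rewrite /site_parity sum_ord_iota; congr odd.
by apply: eq_big_seq => j; rewrite mem_iota => /andP[_ lt_j]; rewrite base_half_in.
Qed.

Lemma site_parity_out_half c k : c < 10 -> site_parity c k =
  odd (\sum_(j <- iota 0 3) M k (base_half (60 + (c * 3 + j))).1).
Proof.
move=> lt_c; rewrite -site_parity_out sum_ord_iota; congr odd.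
by apply: eq_big_seq => j; rewrite mem_iota => /andP[_ lt_j]; rewrite base_half_out.
Qed.

(** The two widening vertices give spoke + link + lane 0 = 1 = link + lane 1 + lane 2; modulo 2 the
    link cancels. *)
Lemma spoke_parity i k : i < 5 -> M k (base_half (5 + i)).1 = site_parity i k.
Proof.
move=> lt_i; have /allP/(_ i) := frame_slots_spoke; rewrite mem_iota lt_i => /(_ isT).
case/and3P=> pu pv _.
have lt_u : 6 * i + 1 < 30 by lia.
have lt_v : 6 * i + 2 < 30 by lia.
have i10 : i < 10 by lia.
have lt5 : 5 + i < 15 by lia.
have lt10 : 10 + i < 15 by lia.
have u6 : (6 * i + 1) %% 6 != 0 by rewrite mulnC modnMDl.
have v6 : (6 * i + 2) %% 6 != 0 by rewrite mulnC modnMDl.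
have eu := base_vertex_sum k lt_u u6 pu; have ev := base_vertex_sum k lt_v v6 pv.
rewrite !big_cons big_nil (base_half_link lt5) in eu.
rewrite !big_cons big_nil (base_half_link lt10) in ev.
rewrite (site_parity_in_half k i10) [iota 0 3]/= !big_cons big_nil.
move: (M k (base_half (5 + i)).1) (M k (base_half (10 + i)).1)
  (M k (base_half (30 + (i * 3 + 0))).1) (M k (base_half (30 + (i * 3 + 1))).1)
  (M k (base_half (30 + (i * 3 + 2))).1) eu ev.
by do 5!case.
Qed.

(** Three vertices each meet one lane of the spoke site and of the two neighbouring ring sites.
    Their three equations add up to the odd number 3, so the three parities sum to 1 modulo 2, which
    is the rule of [ring_step]. *)
Lemma ring_parity i k : i < 5 -> site_parity (5 + i) k =
  ~~ (site_parity (5 + (i + 4) %% 5) k (+) site_parity i k).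
Proof.
move=> lt_i; have /allP/(_ i) := frame_slots_spoke; rewrite mem_iota lt_i => /(_ isT).
case/and3P=> _ _ /allP pz.
have lt_m : (i + 4) %% 5 < 5 by rewrite ltn_pmod.
have i10 : i < 10 by lia.
have i5 : 5 + i < 10 by lia.
have m5 : 5 + (i + 4) %% 5 < 10 by lia.
have sum_z j : j < 3 -> M k (base_half (60 + (i * 3 + j))).1
    + (M k (base_half (30 + ((5 + i) * 3 + j))).1
    + (M k (base_half (60 + ((5 + (i + 4) %% 5) * 3 + j))).1 + 0)) = 1.
  move=> lt_j; have := pz j; rewrite mem_iota lt_j => /(_ isT) pzj.
  have lt_z : 6 * i + (3 + j) < 30 by lia.
  have z6 : (6 * i + (3 + j)) %% 6 != 0 by rewrite mulnC modnMDl modn_small //; lia.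
  have := base_vertex_sum k lt_z z6 pzj.
  by rewrite !big_cons big_nil.
rewrite (site_parity_in_half k i5) (site_parity_out_half k i10) (site_parity_out_half k m5).
rewrite [iota 0 3]/= !big_cons !big_nil.
have := sum_z 0 isT; have := sum_z 1 isT; have := sum_z 2 isT.
move: (M k (base_half (60 + (i * 3 + 0))).1) (M k (base_half (60 + (i * 3 + 1))).1)
  (M k (base_half (60 + (i * 3 + 2))).1) (M k (base_half (30 + ((5 + i) * 3 + 0))).1)
  (M k (base_half (30 + ((5 + i) * 3 + 1))).1) (M k (base_half (30 + ((5 + i) * 3 + 2))).1)
  (M k (base_half (60 + ((5 + (i + 4) %% 5) * 3 + 0))).1)
  (M k (base_half (60 + ((5 + (i + 4) %% 5) * 3 + 1))).1)
  (M k (base_half (60 + ((5 + (i + 4) %% 5) * 3 + 2))).1).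
by do 9!case.
Qed.

Lemma single_parity c : single (cover_of (site_parity c)).
Proof.
have := site_parity_single c; rewrite sum_ord_iota /= !big_cons big_nil /single /cover_of /=.
by rewrite addn0 addnA => ->.
Qed.

Lemma ring_check_spokes : ring_check [seq base_cover (5 + i) | i <- iota 0 5].
Proof.
have coverE i : i < 5 -> base_cover (5 + i) = cover_of (site_parity i).
  by move=> lt_i; rewrite /base_cover /cover_of !spoke_parity.
have stepE i : i < 5 -> ring_step (cover_of (site_parity (5 + (i + 4) %% 5)))
    (cover_of (site_parity i)) = cover_of (site_parity (5 + i)).
  by move=> lt_i; rewrite /ring_step /cover_of /= !(ring_parity _ lt_i).
have -> : [seq base_cover (5 + i) | i <- iota 0 5] = [seq cover_of (site_parity i) | i <- iota 0 5].
  by apply/eq_in_map => i; rewrite mem_iota => /andP[_ lt_i]; apply: coverE.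
apply/andP; split; first by apply/allP => _ /mapP[i _ ->]; apply: single_parity.
(* Site 9 enters the ring at spoke 0, so the scan starts and closes there. *)
apply/hasP; exists (cover_of (site_parity 9)); first exact: mem_covers.
have s0 := stepE 0 isT; have s1 := stepE 1 isT; have s2 := stepE 2 isT.
have s3 := stepE 3 isT; have s4 := stepE 4 isT.
rewrite [map _ _]/= [scanl _ _ _]/= [foldl _ _ _]/=.
rewrite !(s0, s1, s2, s3, s4) eqxx andbT.
by rewrite [all _ _]/= !single_parity.
Qed.

End LowerBound.

Lemma missed_uncovered (G : multigraph) (A : {ffun 'I_3 -> {set edge G}}) :
  \sum_e missed (fun k e => e \in A k) e = #|uncovered A|.
Proof.
rewrite -sum1_card [RHS]big_mkcond; apply: eq_bigr => e _.
by rewrite uncoveredE /missed; case: [forall k, _].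
Qed.

(** * The outer pentagon, before and after inflation *)

(* The outer pentagon in an order that lets [search] prune early: 0-4 are its
   edges, 5-9 its spokes.  In the inflated graph 10, 11, 12 form the triangle. *)
Definition pentagon_order : seq nat := [:: 0; 3; 5; 2; 7; 4; 9; 1; 6; 8].
Definition hexagon_order : seq nat := [:: 0; 10; 12; 3; 11; 5; 2; 7; 4; 9; 1; 6; 8].

Definition pentagon_slots : seq (seq nat) :=
  [:: [:: 0; 3; 5]; [:: 2; 0; 7]; [:: 4; 2; 9]; [:: 1; 4; 6]; [:: 3; 1; 8]].
Definition hexagon_slots : seq (seq nat) :=
  [:: [:: 0; 10; 12]; [:: 3; 11; 10]; [:: 5; 12; 11]] ++ behead pentagon_slots.

Definition positions (order : seq nat) (sl : seq nat) : seq nat := [seq index i order | i <- sl].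

(** If each spoke lies in one matching, the multiplicities of consecutive pentagon edges sum to 2;
    as 5 is odd, all are 1. Together with [ring_check] this would 3-edge-colour the Petersen
    graph. *)
Lemma pentagon_search :
  search covers (partial_check (map (positions pentagon_order) pentagon_slots))
    (fun s => ~~ ring_check [seq nth uncovering s i | i <- positions pentagon_order (iota 5 5)])
    10 [::].
Proof. by vm_compute. Qed.

(** On the hexagon, an even cycle, the multiplicities may alternate between 0 and 2; the first
    alternative of the goal allows for this. *)
Lemma hexagon_search :
  search covers (partial_check (map (positions hexagon_order) hexagon_slots))
    (fun s => (3 <= count (pred1 uncovering) s)
      || ~~ ring_check [seq nth uncovering s i | i <- positions hexagon_order (iota 5 5)])
    13 [::].
Proof. by vm_compute. Qed.

Lemma frame_slots_pentagon : all (fun i =>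
  perm_eq (nth [::] frame_slots (6 * i)) [:: i; 15 + (i + 3) %% 5; 5 + i]) (iota 0 5).
Proof. by vm_compute. Qed.

Definition snark_graph n : multigraph := splice petersen_frame (chain n).

Lemma nth_positions (w : nat -> 'I_3 -> bool) order sl : {subset sl <= order} ->
  [seq nth uncovering [seq cover_of (w j) | j <- order] i | i <- positions order sl] =
  [seq cover_of (w j) | j <- sl].
Proof.
move=> sub; rewrite -map_comp; apply/eq_in_map => j /sub jo /=.
by rewrite (nth_map 0) ?index_mem // nth_index.
Qed.

(** Transfers a search to an assignment indexed by edges; [order] only decides when each edge is
    assigned. *)
Lemma order_search order slots goal (w : nat -> 'I_3 -> bool) :
  search covers (partial_check (map (positions order) slots)) goal (size order) [::] ->
  {in slots, forall sl, {subset sl <= order}} ->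
  {in slots, forall sl k, \sum_(j <- sl) w j k = 1} ->
  goal [seq cover_of (w j) | j <- order].
Proof.
move=> srch sub w1; apply: (searchP srch) => [|c _|]; rewrite ?size_map ?mem_covers //.
apply: partial_check_take; apply/allP => _ /mapP[sl slin ->]; rewrite size_map.
apply/andP; split.
  by apply/allP => _ /mapP[j jsl ->] /=; rewrite index_mem (sub _ slin).
rewrite (nth_positions w (sub _ slin)); apply/allP => k; rewrite mem_iota => /andP[_ lt_k] /=.
rewrite count_map -(w1 _ slin (inord k)) -sum1_count [X in X == _]big_mkcond; apply/eqP.
apply: eq_bigr => j _; rewrite /= -[k in in_cover k](inordK lt_k) in_cover_of.
by case: (w j _).
Qed.

Lemma sub_order (order : seq nat) slots : all (all [in order]) slots ->
  {in slots, forall sl : seq nat, {subset sl <= order}}.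
Proof. by move=> /allP sub sl /sub /allP. Qed.

Section Pentagon.
Variable n : nat.
Notation G := (snark_graph n).

Lemma pentagon_vertex_sum (M : 'I_3 -> edge G -> bool) i k : i < 5 ->
  vertex_sum (fun h => M k h.1) (inl (inord (6 * i)) : vertex G) =
  \sum_(j <- [:: i; (i + 3) %% 5; 5 + i]) M k (base_half n j).1.
Proof.
move=> lt_i; have lt_6i : 6 * i < 30 by lia.
have /allP/(_ i) := frame_slots_pentagon; rewrite mem_iota lt_i => /(_ isT) perm_p.
rewrite (base_sumE (fun h => M k h.1)) (inordK lt_6i) (perm_big _ perm_p) !big_cons !big_nil.
have lt_m : (i + 3) %% 5 < 15 by apply: leq_trans (ltn_pmod _ _) _.
by rewrite (base_half_link n lt_m).
Qed.

Lemma snark_uncovered (A : {ffun 'I_3 -> {set edge G}}) : three_array A -> n <= #|uncovered A|.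
Proof.
move=> /three_arrayP A3; rewrite leqNgt -missed_uncovered; apply/negP => few.
pose M k e := e \in A k.
have chk : ring_check [seq base_cover M (5 + i) | i <- iota 0 5].
  by apply: (ring_check_spokes (n := n)) => // k w _; apply: A3.
have slot1 : {in pentagon_slots, forall sl k, \sum_(j <- sl) M k (base_half n j).1 = 1}.
  have at_p i k : i < 5 -> \sum_(j <- [:: i; (i + 3) %% 5; 5 + i]) M k (base_half n j).1 = 1.
    by move=> lt_i; rewrite -pentagon_vertex_sum //; apply: A3.
  move=> sl; rewrite !inE => /or4P[|||/orP[]] /eqP -> k;
    [exact: (at_p 0)|exact: (at_p 2)|exact: (at_p 4)|exact: (at_p 1)|exact: (at_p 3)].
have := order_search (w := fun j k => M k (base_half n j).1) pentagon_search (@sub_order pentagon_order pentagon_slots isT) slot1.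
rewrite nth_positions; last by apply/allP.
by rewrite (iotaDl 5 0 5) -map_comp => /negP; apply.
Qed.

End Pentagon.

(** * The snarks and their inflations *)

Section SnarkGraph.
Variable n : nat.
Notation G := (snark_graph n).

Lemma snark_cubic : cubic G.
Proof. exact: splice_cubic sound_petersen_frame (chain_sound n). Qed.

Lemma snark_cuts (X : vertex G -> bool) u w : X u -> ~~ X w -> 2 <= cut X.
Proof.
move=> Xu Xw.
have X0 : 0 < size_of X by rewrite size_ofE; apply/card_gt0P; exists u.
have nX0 : 0 < size_of (predC X) by rewrite size_ofE; apply/card_gt0P; exists w.
have girthX := splice_girth sound_petersen_frame (chain_sound n).
have [X1|X1] := leqP (size_of X) 1.
  by apply: leq_trans (leq_addl _ 2) (girthX X _); rewrite X0 (leq_trans X1).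
have [nX1|nX1] := leqP (size_of (predC X)) 1.
  by rewrite -cutC; apply: leq_trans (leq_addl _ 2) (girthX _ _); rewrite nX0 (leq_trans nX1).
exact: leq_trans (splice_cuts sound_petersen_frame (chain_sound n) X1 nX1).
Qed.

Lemma snark_card : 2 < #|vertex G|.
Proof. by rewrite card_sum card_ord. Qed.

Lemma snark_small_cut (X : vertex G -> bool) :
  0 < #|[pred v | X v]| <= 4 -> #|[pred v | X v]| + 2 <= cut X.
Proof. by rewrite -size_ofE; apply: splice_girth sound_petersen_frame (chain_sound n) X. Qed.

Lemma snark_defect : n <= defect G.
Proof.
apply: defect_geq; last exact: snark_uncovered.
rewrite !card_sum card_prod.
apply: leq_trans (ltnW (card_chain n)) _.
by rewrite addnCA; apply: leq_trans (leq_addr _ _); rewrite leq_pmull // card_ord.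
Qed.

Lemma snark_nontrivial : 0 < n -> nontrivial_snark G.
Proof.
move=> n0; split.
- split; first exact: snark_cubic.
    apply: two_connected_of_cuts; [exact: snark_cubic|exact: snark_card|exact: snark_cuts].
  apply: not_colourable_of_defect; [exact: snark_cubic|exact: leq_trans n0 snark_defect].
- apply: (cyclically_4_edge_connected_of_cuts snark_cubic snark_small_cut) => X X1 nX1.
  by apply: (splice_cuts sound_petersen_frame (chain_sound n)); rewrite size_ofE.
exact: girth_5_of_cuts snark_cubic snark_small_cut.
Qed.

Definition apex : vertex G := inl (inord 0).

(* Links 0 and 3 are the pentagon edges at [apex], link 5 is its spoke. *)
Definition apex_attach (h : edge G * bool) : 'I_3 :=
  if h.1 is inl e then inord (nth 2 [:: 0; 2; 2; 1] (e : 'I_15)) else inord 2.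

Notation H := (inflate apex apex_attach).

Lemma base_half_small j : j < 15 -> base_half n j = (inl (inord j), false).
Proof. by move=> lt_j; rewrite /base_half (frame_slot_first _ _ _ lt_j). Qed.

Lemma base_half_large j : j < 15 -> base_half n (15 + j) = (inl (inord j), true).
Proof. by move=> lt_j; rewrite /base_half (frame_slot_second _ _ _ lt_j). Qed.

Lemma apex_attach_half : [/\ apex_attach (base_half n 0) = inord 0,
  apex_attach (base_half n (15 + 3)) = inord 1 & apex_attach (base_half n 5) = inord 2].
Proof.
by rewrite base_half_large // !base_half_small // /apex_attach /= !inordK.
Qed.

Lemma apex_sum (F : edge G * bool -> nat) :
  vertex_sum F apex = F (base_half n 0) + F (base_half n (15 + 3)) + F (base_half n 5).
Proof.
rewrite base_sumE inordK //.
have /(perm_big _) -> : perm_eq (nth [::] frame_slots 0) [:: 0; 15 + 3; 5] by [].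
by rewrite !big_cons big_nil -[RHS]addnA -[X in _ = _ + (_ + X)]addn0.
Qed.

Lemma ord_pred3 i : i < 3 -> ord_pred (inord i : 'I_3) = inord ((i + 2) %% 3).
Proof.
move=> lt_i; apply: val_inj; rewrite /= !inordK ?ltn_pmod //.
by rewrite addnS.
Qed.

Lemma triangle_sum (F : edge H * bool -> nat) j : j < 3 ->
  vertex_sum F (inr (inord j) : vertex H) =
    F (inl (base_half n (nth 0 [:: 0; 15 + 3; 5] j)).1, (base_half n (nth 0 [:: 0; 15 + 3; 5] j)).2)
    + (F (inr (inord j), false) + F (inr (inord ((j + 2) %% 3)), true)).
Proof.
move=> lt_j; rewrite inflate_sum_inr ord_pred3 //; congr (_ + _).
have [a0 a1 a2] := apex_attach_half.
rewrite apex_sum a0 a1 a2 !inord_eq // !inordK //.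
by case: j lt_j => [|[|[|//]]] _; rewrite ?mul0n ?mul1n ?addn0 ?add0n.
Qed.

Lemma inflate_cubic : cubic H.
Proof.
move=> [u|j]; rewrite degree_inE.
  rewrite inflate_sum_inl -[RHS](snark_cubic (val u)) degree_inE.
  by apply: eq_bigr => h _; rewrite !in_setT.
by rewrite -(inord_val j) triangle_sum // !in_setT.
Qed.

Lemma apex_attaches_distinctly : attaches_distinctly apex apex_attach.
Proof.
have [a0 a1 a2] := apex_attach_half.
(* [apex_sum] applied to the indicator of [h]: exactly one of the three listed half-edges is [h]. *)
have at_apex h : h \in half_edges_at apex -> (base_half n 0 == h)
    + (base_half n (15 + 3) == h) + (base_half n 5 == h) = 1 :> nat.
  rewrite inE => h_apex; rewrite -(apex_sum (fun h' => h' == h)).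
  rewrite /vertex_sum (bigD1 h) //= h_apex eqxx big1 // => h' /negPf ->.
  by rewrite muln0.
have inj3 i j : i < 3 -> j < 3 -> inord i = inord j :> 'I_3 -> i = j.
  by move=> lt_i lt_j /(congr1 (@nat_of_ord 3)); rewrite !inordK.
move=> h h' /at_apex hA /at_apex hA'.
have from3 g : (base_half n 0 == g) + (base_half n (15 + 3) == g) + (base_half n 5 == g) = 1 ->
    [\/ g = base_half n 0, g = base_half n (15 + 3) | g = base_half n 5].
  by case: eqP => [<-|_]; [constructor 1|case: eqP => [<-|_];
    [constructor 2|case: eqP => [<-|//]; constructor 3]].
case: (from3 _ hA) => ->; case: (from3 _ hA') => ->; rewrite ?a0 ?a1 ?a2 //;
  by move/inj3 => /(_ isT isT).
Qed.

(** At most two uncovered edges are fewer than [n], so the spokes still pass [ring_check], and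
    [hexagon_search] then finds three uncovered edges. *)
Lemma inflate_uncovered (A : {ffun 'I_3 -> {set edge H}}) :
  2 < n -> three_array A -> 3 <= #|uncovered A|.
Proof.
move=> n2 /three_arrayP A3; rewrite leqNgt; apply/negP => few.
pose M k (e : edge G) := inl e \in A k.
have Mvertex k w : w != apex -> vertex_sum (fun h => M k h.1) w = 1.
  by move=> wA; rewrite -[RHS](A3 k (inl (Sub w wA))) inflate_sum_inl.
have chk : ring_check [seq base_cover M (5 + i) | i <- iota 0 5].
  apply: (ring_check_spokes (n := n)) => [k w wP|].
    by apply: Mvertex; apply: (wP ord0).
  apply: leq_ltn_trans (leq_trans few n2).
  by rewrite -missed_uncovered [leqRHS]big_sumType; apply: leq_addr.
pose e j : edge H := if j < 10 then inl (base_half n j).1 else inr (inord (j - 10)).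
pose w j k := e j \in A k.
have wM j k : j < 10 -> w j k = M k (base_half n j).1.
  by rewrite /w /e => ->.
have slot1 : {in hexagon_slots, forall sl k, \sum_(j <- sl) w j k = 1}.
  have at_p i k : 0 < i < 5 -> \sum_(j <- [:: i; (i + 3) %% 5; 5 + i]) w j k = 1.
    case/andP=> i0 lt_i.
    transitivity (vertex_sum (fun h => M k h.1) (inl (inord (6 * i)) : vertex G)).
      rewrite pentagon_vertex_sum //; apply: eq_big_seq => j; rewrite !inE => jp.
      by rewrite wM //; have := ltn_pmod (i + 3) (isT : 0 < 5); lia.
    apply: Mvertex; apply/negP => /eqP[] /(congr1 (@nat_of_ord 30)); rewrite !inordK //; lia.
  have at_t j k : j < 3 -> w (nth 0 [:: 0; 3; 5] j) k + (w (10 + j) k + w (10 + (j + 2) %% 3) k) = 1.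
    move=> lt_j; rewrite -[RHS](A3 k (inr (inord j))) (triangle_sum (fun h => h.1 \in A k)) //.
    congr (_ + (_ + _)); rewrite /w /e; try by rewrite ltnNge leq_addr addKn.
    have h18 := base_half_link n (isT : 3 < 15).
    case: j lt_j => [|[|[|//]]] _; [by []| |by []].
    by congr (_ \in _); rewrite [RHS]/= h18.
  move=> sl; rewrite -[hexagon_slots]/([:: [:: 0; 10; 12]; [:: 3; 11; 10]; [:: 5; 12; 11];
    [:: 2; 0; 7]; [:: 4; 2; 9]; [:: 1; 4; 6]; [:: 3; 1; 8]]) !inE => sl_in k.
  case/or4P: sl_in => [/eqP->|/eqP->|/eqP->|/or4P[] /eqP->].
  - by rewrite !big_cons big_nil addn0; exact: (at_t 0).
  - by rewrite !big_cons big_nil addn0; exact: (at_t 1).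
  - by rewrite !big_cons big_nil addn0; exact: (at_t 2).
  - exact: (at_p 2).
  - exact: (at_p 4).
  - exact: (at_p 1).
  exact: (at_p 3).
have := order_search (w := w) hexagon_search (@sub_order hexagon_order hexagon_slots isT) slot1.
rewrite nth_positions; last by apply/allP.
have -> : [seq cover_of (w j) | j <- iota 5 5] = [seq base_cover M (5 + i) | i <- iota 0 5].
  rewrite (iotaDl 5 0 5) -map_comp; apply/eq_in_map => i; rewrite mem_iota => /andP[_ lt_i] /=.
  by rewrite /base_cover /cover_of !wM //; lia.
rewrite chk orbF leqNgt => /negP; apply; apply: leq_trans few; rewrite ltnS.
rewrite count_map -size_filter -(size_map e).
(* Different positions of the search are different edges, so uncovered positions count uncovered
   edges. *)
have uniq_e : uniq [seq e j | j <- hexagon_order & preim (fun j => cover_of (w j)) (pred1 uncovering) j].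
  rewrite map_inj_in_uniq ?filter_uniq // => i j; rewrite !mem_filter => /andP[_ io] /andP[_ jo].
  have lt13 : all (gtn 13) hexagon_order by [].
  have /= lt_i13 := allP lt13 _ io; have /= lt_j13 := allP lt13 _ jo; rewrite /e.
  case: (ltnP i 10) => [lt_i|le_i]; case: (ltnP j 10) => [lt_j|le_j] //.
    rewrite !base_half_small; try lia.
    move=> [] eij; have := congr1 (@nat_of_ord 15) eij; rewrite !inordK //; lia.
  move=> [] eij; have := congr1 (@nat_of_ord 3) eij; rewrite !inordK; lia.
rewrite -(card_uniqP uniq_e); apply/subset_leq_card/subsetP => f /mapP[j + ->].
rewrite mem_filter => /andP[/eqP[w0 w1 w2] _].
rewrite uncoveredE; apply/forallP => k; rewrite -(inord_val k).
by case: k => -[|[|[|//]]] lt_k /=; rewrite -/(w j _) ?w0 ?w1 ?w2.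
Qed.

End SnarkGraph.

(** * A three-array of the inflation with three uncovered edges *)

(* A 3-edge-colouring of the graph without the pentagon; the links 0-4 are the
   pentagon, the first five sites the spokes. *)
Definition link_covers : seq cover3 :=
  [:: (false, true, true); uncovering; uncovering; (true, false, true); (true, true, false);
      (false, false, true); (false, false, true); (true, false, false); (false, true, false);
      (false, false, true);
      (true, false, false); (true, false, false); (false, false, true); (true, false, false);
      (false, true, false)].

Definition site_states : seq (seq nat) :=
  [:: [:: 1; 2; 1]; [:: 1; 2; 1]; [:: 1; 0; 1]; [:: 2; 1; 2]; [:: 0; 2; 0];
      [:: 0; 0; 0]; [:: 2; 1; 2]; [:: 0; 2; 0]; [:: 1; 0; 1]; [:: 2; 1; 2]].

(** Triangle edge 0 lies on the hexagon and stays uncovered; the other two take the colours missing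
    at the spoke. *)
Definition triangle_covers : seq cover3 :=
  [:: uncovering; (false, true, false); (true, false, false)].

Definition colour_cover (x : nat) : cover3 := (x == 0, x == 1, x == 2).

Definition lane_cover (i : nat) : cover3 :=
  colour_cover (nth 0 (nth [::] site_states (i %/ 3)) (i %% 3)).

Definition base_value (i : nat) : cover3 :=
  if i < 15 then nth uncovering link_covers i else
  if i < 30 then nth uncovering link_covers (i - 15) else
  if i < 60 then lane_cover (i - 30) else lane_cover (i - 60).

(** Vertex 0 is left out: there the third matching would contain all three edges, a conflict that
    the triangle resolves. *)
Lemma base_value_check : all (fun u => all (gtn 90) (nth [::] frame_slots u)
    && count_covers (pred1 1) [seq base_value i | i <- nth [::] frame_slots u]) (iota 1 29).
Proof. by vm_compute. Qed.

Lemma triangle_value_check : all (fun j => count_covers (pred1 1)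
    [:: base_value (nth 0 [:: 0; 15 + 3; 5] j); nth uncovering triangle_covers j;
        nth uncovering triangle_covers ((j + 2) %% 3)]) (iota 0 3).
Proof. by vm_compute. Qed.

Lemma in_colour_cover (k : 'I_3) x : x < 3 -> in_cover k (colour_cover x) = (inord x == k :> 'I_3).
Proof. by move=> lt_x; rewrite inord_eq //; case: k => -[|[|[|]]]. Qed.

Lemma site_state_lt c j : nth 0 (nth [::] site_states c) j < 3.
Proof.
have ok : all (all (gtn 3)) site_states by [].
have [lt_c|le_c] := ltnP c (size site_states); last by rewrite (nth_default _ le_c) nth_nil.
have [lt_j|le_j] := ltnP j (size (nth [::] site_states c)); last by rewrite nth_default.
exact: (allP (allP ok _ (mem_nth _ lt_c)) _ (mem_nth _ lt_j)).
Qed.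

Section InflateArray.
Variable n : nat.
Notation G := (snark_graph n).
Notation H := (inflate (apex n) (apex_attach (n := n))).

Lemma site_colouring : exists c : 'I_10 -> pole_edge (chain n) -> 'I_3,
  forall i, pole_matchings (fun k e => c i e == k)
    (fun k j => colours (nth [::] site_states i) j == k)
    (fun k j => colours (nth [::] site_states i) j == k).
Proof.
have ok : all (fun s => s \in chain_states) site_states by [].
suff /fin_all_exists[c c_ok] : forall i : 'I_10, exists c : pole_edge (chain n) -> 'I_3,
    pole_matchings (fun k e => c e == k)
      (fun k j => colours (nth [::] site_states i) j == k)
      (fun k j => colours (nth [::] site_states i) j == k) by exists c.
by move=> i; apply: chain_transmits; apply: (allP ok); rewrite mem_nth.
Qed.

Lemma inflate_defect_le : defect H <= 3.
Proof.
have [c c_ok] := site_colouring.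
pose B (k : 'I_3) (e : edge G) : bool := match e with
  | inl e => in_cover k (nth uncovering link_covers (e : 'I_15))
  | inr (inl (i, e)) => c i e == k
  | inr (inr (inl (i, j))) => colours (nth [::] site_states (i : 'I_10)) j == k
  | inr (inr (inr (i, j))) => colours (nth [::] site_states (i : 'I_10)) j == k
  end.
pose BH (k : 'I_3) (e : edge H) : bool := match e with
  | inl e => B k e
  | inr j => in_cover k (nth uncovering triangle_covers j)
  end.
pose A := [ffun k => [set e | BH k e]].
have AE k e : (e \in A k) = BH k e by rewrite ffunE inE.
have half_value k i : i < 90 -> B k (base_half n i).1 = in_cover k (base_value i).
  move=> lt_i; rewrite /base_value.
  have [lt15|ge15] := ltnP i 15; first by rewrite base_half_small //= inordK.
  have [lt30|ge30] := ltnP i 30.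
    by rewrite -{1}(subnKC ge15) base_half_large /= ?inordK //; lia.
  have lane m : m < 30 -> (inord (m %/ 3) : 'I_10) = m %/ 3 :> nat /\ (inord (m %% 3) : 'I_3) = m %% 3 :> nat.
    by move=> lt_m; rewrite !inordK // ?ltn_pmod //; have := ltn_divLR m 10 (isT : 0 < 3); lia.
  have [lt60|ge60] := ltnP i 60.
    have lt_m : i - 30 < 30 by lia.
    have [e1 e2] := lane _ lt_m.
    rewrite -{1}(subnKC ge30) /base_half (frame_slot_in _ _ _ lt_m) /= e1.
    by rewrite /colours e2 -in_colour_cover ?site_state_lt.
  have lt_m : i - 60 < 30 by lia.
  have [e1 e2] := lane _ lt_m.
  rewrite -{1}(subnKC ge60) /base_half (frame_slot_out _ _ _ lt_m) /= e1.
  by rewrite /colours e2 -in_colour_cover ?site_state_lt.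
have A3 : three_array A.
  apply/three_arrayP => k [u|j].
    rewrite inflate_sum_inl; case: u => -[u|[i y]] u0 /=.
      rewrite -[LHS]/(vertex_sum (fun h => inl h.1 \in A k) (inl u : vertex G)).
      rewrite base_sumE; have /allP/(_ (u : nat)) := base_value_check.
      have u_gt0 : 0 < u.
        rewrite lt0n; apply: contra u0 => /eqP u_eq0; apply/eqP; congr inl.
        by apply: (@ord_inj 30); rewrite u_eq0 inordK.
      rewrite mem_iota u_gt0 (ltn_ord u) => /(_ isT)/andP[/allP lt90 /allP/(_ (k : nat))].
      rewrite mem_iota ltn_ord => /(_ isT)/eqP cnt; rewrite -[RHS]cnt count_map -sum1_count.
      rewrite [RHS]big_mkcond; apply: eq_big_seq => i /lt90 lt_i.
      by rewrite AE /= half_value //; case: (in_cover _ _).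
    rewrite -[LHS]/(vertex_sum (fun h => inl h.1 \in A k) (inr (i, y) : vertex G)).
    rewrite (splice_sum_pole (fun e => inl e \in A k)) -[RHS](c_ok i k y).
    by apply: eq_pole_sum => z; rewrite AE.
  rewrite -(inord_val j) triangle_sum // !AE.
  have /allP/(_ (j : nat)) := triangle_value_check.
  rewrite mem_iota ltn_ord => /(_ isT)/allP/(_ (k : nat)).
  rewrite mem_iota ltn_ord => /(_ isT)/eqP; rewrite /= addn0 => cnt; rewrite -[RHS]cnt.
  rewrite half_value; last by case: (j) => -[|[|[|]]].
  by rewrite !inordK ?ltn_pmod.
apply: leq_trans (defect_leq A3) _.
(* Pentagon edges 1 and 2 and triangle edge 0 are alternate edges of the hexagon; every edge inside
   a site has a colour. *)
apply: leq_trans (card_size [:: inl (inl (inord 1 : 'I_15)); inl (inl (inord 2 : 'I_15)); inr (inord 0)]).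
apply/subset_leq_card/subsetP => e; rewrite uncoveredE => /forallP eA.
have {}eA k : ~~ BH k e by rewrite -AE.
case: e eA => [[e|[[i e]|[[i j]|[i j]]]]|j] eA.
- have e0 : nth uncovering link_covers (e : 'I_15) = uncovering.
    have := eA (inord 0); have := eA (inord 1); have := eA (inord 2); rewrite /= !inordK //.
    by case: (nth _ _ _) => -[[] []] [].
  have chk : all (fun i => (nth uncovering link_covers i == uncovering) ==> (i \in [:: 1; 2])) (iota 0 15).
    by vm_compute.
  have /allP/(_ (e : 'I_15)) := chk; rewrite mem_iota ltn_ord => /(_ isT)/implyP; rewrite e0 => /(_ isT).
  rewrite !inE => /orP[] /eqP e12; apply/orP; [left|right; apply/orP; left];
    by apply/eqP; congr (inl (inl _)); apply: (@ord_inj 15); rewrite e12 inordK.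
- by have := eA (c i e); rewrite /= eqxx.
- by have := eA (colours (nth [::] site_states (i : 'I_10)) j); rewrite /= eqxx.
- by have := eA (colours (nth [::] site_states (i : 'I_10)) j); rewrite /= eqxx.
have := eA (inord 0); have := eA (inord 1); rewrite /= !inordK //.
case: j eA => -[|[|[|]]] //= lt_j _ _ _.
rewrite !inE; apply/orP; right; apply/orP; right; apply/eqP; congr inr.
by apply: (@ord_inj 3); rewrite inordK.
Qed.

End InflateArray.

Theorem theorem5p3 (n : nat) (hn : 3 <= n) :
  exists G : multigraph,
    [/\ nontrivial_snark G,
        n <= defect G
      & exists (v : vertex G) (attach : edge G * bool -> 'I_3),
          [/\ attaches_distinctly v attach,
              snark (inflate v attach)
            & defect (inflate v attach) = 3]].
Proof.
exists (snark_graph n); split.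
- by apply: snark_nontrivial; apply: leq_trans hn.
- exact: snark_defect.
have defect_ge3 : 3 <= defect (inflate (apex n) (apex_attach (n := n))).
  apply: defect_geq => [|A]; last exact: inflate_uncovered.
  by rewrite card_sum card_ord addnC.
exists (apex n), (apex_attach (n := n)); split.
- exact: apex_attaches_distinctly.
- split; first exact: inflate_cubic.
    apply: two_connected_of_cuts; first exact: inflate_cubic.
      by rewrite card_sum card_ord addn3.
    exact/inflate_cuts/snark_cuts.
  by apply: not_colourable_of_defect; [exact: inflate_cubic|apply: leq_trans defect_ge3].
by apply/eqP; rewrite eqn_leq inflate_defect_le.
Qed.
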